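(* $\mathcal{T}_{h+1}$-Free Edge Deletion can be solved on $n$-vertex split graphs in time $\mathcal{O}((k+1)^{k+2}n^{1+o(1)})$, where $k$ is the solution size bound of the instance.
   Context: $\mathcal{T}_{h+1}$-Free Edge Deletion: given a simple undirected graph $G$ and positive integers $k,h$, decide whether there is $F\subseteq E(G)$ with $|F|\le k$ such that every connected component of $G\setminus F$ has at most $h$ vertices. A graph is a split graph if its vertex set can be partitioned into a clique and an independent set. *)

(* Defs.v *)
From mathcomp Require Import all_boot.

Set Implicit Arguments.
Unset Strict Implicit.
Unset Printing Implicit Defensive.

Local Open Scope nat_scope.

Record sgraph (n : nat) := SGraph {
  edge : rel 'I_n;
  edge_sym : symmetric edge;
  edge_irr : irreflexive edge
}.

Section Graphs.
Variables (n : nat) (G : sgraph n).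
Implicit Types (F : {set {set 'I_n}}) (C I : {set 'I_n}).

Definition edge_set : {set {set 'I_n}} :=
  [set e | [exists x, exists y, edge G x y && (e == [set x; y])]].

Definition clique C : Prop := {in C &, forall x y, x != y -> edge G x y}.

Definition independent I : Prop := {in I &, forall x y, ~~ edge G x y}.

Definition split_graph : Prop := exists C, clique C /\ independent (~: C).

(* Adjacency in G \ F. *)
Definition del_edges F : rel 'I_n :=
  [rel x y | edge G x y && ([set x; y] \notin F)].

Definition components (e : rel 'I_n) : {set {set 'I_n}} :=
  equivalence_partition (connect e) [set: 'I_n].

(* T_{h+1}-Free Edge Deletion on the instance (G, k, h). *)
Definition tree_free_edge_deletion (k h : nat) : bool :=
  [exists F : {set {set 'I_n}},
    [&& F \subset edge_set, #|F| <= k &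
        [forall A in components (del_edges F), #|A| <= h]]].

(* The neighbours of each vertex may be listed in any order. *)
Definition adjacency_lists (adj : 'I_n -> seq 'I_n) : Prop :=
  forall x, uniq (adj x) /\ adj x =i edge G x.

End Graphs.

(* Word RAM with w-bit words: registers and memory cells hold numbers below
   2 ^ w, every instruction costs one unit of time.  A program is a fixed finite
   list of instructions, independent of the input and of w; hence it mentions
   only finitely many registers. *)

Inductive binop :=
  | OAdd | OSub | OMul | ODiv | OMod | OAnd | OOr | OXor | OShl | OShr.

Inductive instr :=
  | IConst of nat & nat          (* IConst d c:   r_d := c                   *)
  | IOp of binop & nat & nat & nat
                                 (* IOp o d a b:  r_d := r_a o r_b           *)
  | ILoad of nat & nat           (* ILoad d a:    r_d := mem[r_a]            *)
  | IStore of nat & nat          (* IStore a b:   mem[r_a] := r_b            *)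
  | IJumpLt of nat & nat & nat   (* IJumpLt a b l: go to l if r_a < r_b      *)
  | IHalt of bool.               (* halt and answer yes (true) or no (false) *)

Definition program := seq instr.

Record state := State {
  st_pc : nat;
  st_reg : nat -> nat;
  st_mem : nat -> nat
}.

Definition update (f : nat -> nat) (i x : nat) : nat -> nat :=
  fun j => if j == i then x else f j.

Section WordRAM.
Variable w : nat.

(* Results are truncated to w bits.  The operands are below 2 ^ w, so OSub is
   subtraction modulo 2 ^ w.  Dividing by 0 follows the conventions of %/, %%. *)
Definition eval_op (o : binop) (x y : nat) : nat :=
  (match o with
   | OAdd => x + y
   | OSub => x + 2 ^ w - y
   | OMul => x * y
   | ODiv => x %/ y
   | OMod => x %% y
   | OAnd => Nat.land x y
   | OOr => Nat.lor x y
   | OXor => Nat.lxor x y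
   | OShl => x * 2 ^ y
   | OShr => x %/ 2 ^ y
   end) %% 2 ^ w.

(* Leaving the program text counts as answering no. *)
Definition current (P : program) (s : state) : instr :=
  nth (IHalt false) P (st_pc s).

Definition step (P : program) (s : state) : state :=
  let: State p r m := s in
  match current P s with
  | IConst d c => State p.+1 (update r d (c %% 2 ^ w)) m
  | IOp o d a b => State p.+1 (update r d (eval_op o (r a) (r b))) m
  | ILoad d a => State p.+1 (update r d (m (r a))) m
  | IStore a b => State p.+1 r (update m (r a) (r b))
  | IJumpLt a b l => State (if r a < r b then l else p.+1) r m
  | IHalt _ => s
  end.

(* The input occupies the first memory cells; everything else is 0. *)
Definition init (input : seq nat) : state :=
  State 0 (fun=> 0) (nth 0 input).

Definition halts_within (P : program) (input : seq nat) (t : nat) (b : bool) :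
    Prop :=
  current P (iter t (step P) (init input)) = IHalt b.

End WordRAM.

(* w >= c * log2 N, where N bounds the length and the entries of the input;
   for c > 0 and a nonempty input, all entries and addresses fit in a word. *)
Definition word_size_ok (c w : nat) (input : seq nat) : Prop :=
  (size input + \max_(x <- input) x) ^ c <= 2 ^ w.

(* Adjacency-array representation: with n the number of lists, the cells are
   n, k, h, then n + 1 pointers, then the lists one after the other.  List v
   occupies the cells from pointer v (included) to pointer v + 1 (excluded). *)
Definition encode (lists : seq (seq nat)) (k h : nat) : seq nat :=
  let n := size lists in
  [:: n; k; h] ++
  [seq n + 4 + sumn (take v (shape lists)) | v <- iota 0 n.+1] ++
  flatten lists.

Definition encode_instance (n : nat) (adj : 'I_n -> seq 'I_n) (k h : nat) :
    seq nat :=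
  encode [seq [seq val y | y <- adj x] | x <- enum 'I_n] k h.

(* Main.v *)
(* Let K = k + 1.  Deleting at most k edges amounts to labelling the vertices so
   that every label is used at most h times and at most k edges join different
   labels.  Two vertices of the clique with different labels already force about
   |C| - 1 cut edges, so there are two cases.

   If all clique vertices share a label, the other vertices lose all their edges
   or none: it is optimal to isolate those of least degree, which the degree
   sequence alone decides, even when the clique is large.

   Otherwise |C| <= K, and |C| - 1 plus the number of vertices outside C that see
   two labels is at most k.  So there are at most K labels to guess; the first one
   is 0 without loss of generality, which leaves K ^ k guesses.  Once they are
   made, any other vertex either takes the common label of its neighbours or is
   isolated, and again the vertices of least degree in each class go first.  A
   guess is evaluated in time O(K ^ 2 * n).

   The clique is found as the set of vertices of degree at least D for some D, by
   the equality case of the Erdos-Gallai inequality.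

   The RAM program is the translation of a structured program with the same running
   time. *)
Require Import Defs.
From mathcomp Require Import all_boot zify.

Set Implicit Arguments.
Unset Strict Implicit.
Unset Printing Implicit Defensive.

(** * Structured programs on the word RAM *)

(** Soundness and completeness are asymmetric. Every guess, even an absurd one, is completed to a
    genuine labelling that cuts at most as many edges as the guess costs, so guesses need no
    consistency check. Conversely, a labelling with few cut edges only has to be matched by one
    guess: its labels are renumbered by first occurrence among the clique vertices, and all labels
    absent from the clique share one further number, which is harmless because an outside vertex
    with such a label has lost all its edges.

    Sorting by degree is avoided: the cost of a least-weight removal is read off from the sizes of
    level sets. Only K levels are inspected, since a removed vertex of weight at least K exceeds the
    budget anyway.

    All comparisons of costs with numbers of cut edges charge each edge to one of its ends: the one
    outside the clique, or the later of two clique vertices. *)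

Inductive expr :=
  | Var of nat | Cst of nat
  | Add of expr & expr | Sub of expr & expr | Mul of expr & expr
  | Inp of expr | Arr of nat & expr.

Inductive cmd :=
  | Skip
  | Asg of nat & expr
  | Sto of nat & expr & expr
  | Seq of cmd & cmd
  | If of expr & expr & cmd & cmd
  | While of nat & expr & expr & cmd.

Record store := Store { reg : nat -> nat; arr : nat -> nat -> nat }.

Definition setr (s : store) x a := Store (update (reg s) x a) (arr s).

Definition seta (s : store) t i a :=
  Store (reg s) (fun t' => if t' == t then update (arr s t) i a else arr s t').

(* Registers below [base_reg] are program variables, [base_reg] holds the length
   of the input, and expressions are evaluated in the registers above it. *)
Definition base_reg := 30.
Definition tmp_reg := 31.

Fixpoint wfe (e : expr) : bool :=
  match e with
  | Var x => x < base_reg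
  | Cst _ => true
  | Add a b | Sub a b | Mul a b => wfe a && wfe b
  | Inp a => wfe a
  | Arr t a => (t < 3) && wfe a
  end.

Fixpoint wfc (c : cmd) : bool :=
  match c with
  | Skip => true
  | Asg x e => (x < base_reg) && wfe e
  | Sto t a b => [&& t < 3, wfe a & wfe b]
  | Seq c d => wfc c && wfc d
  | If a b c d => [&& wfe a, wfe b, wfc c & wfc d]
  | While _ a b c => [&& wfe a, wfe b & wfc c]
  end.

(** Expressions compile to straight-line code, so its length is also its running time. *)
Fixpoint esz (e : expr) : nat :=
  match e with
  | Var _ => 0
  | Cst _ => 1
  | Add a b | Sub a b | Mul a b => esz a + esz b + 1
  | Inp a => esz a + 1
  | Arr _ a => esz a + 6
  end.

(** The three arrays are interleaved with stride 3 behind the input, so none of them needs a size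
    fixed in advance. *)
Definition addr_code d i a :=
  [:: IConst d.+1 3; IOp OMul d i d.+1; IOp OAdd d d base_reg;
      IConst d.+1 a; IOp OAdd d d d.+1].

Fixpoint comp_expr (e : expr) (d : nat) : seq instr * nat :=
  let bin o a b :=
    let ca := comp_expr a d in
    let cb := comp_expr b d.+1 in
    (ca.1 ++ cb.1 ++ [:: IOp o d ca.2 cb.2], d) in
  match e with
  | Var x => ([::], x)
  | Cst c => ([:: IConst d c], d)
  | Add a b => bin OAdd a b
  | Sub a b => bin OSub a b
  | Mul a b => bin OMul a b
  | Inp a => let ca := comp_expr a d in (ca.1 ++ [:: ILoad d ca.2], d)
  | Arr t a =>
      let ca := comp_expr a d in
      (ca.1 ++ addr_code d ca.2 t ++ [:: ILoad d d], d)
  end.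

(** The only jump is conditional; [0 < 1] makes it unconditional. *)
Definition jump_code l :=
  [:: IConst tmp_reg 0; IConst tmp_reg.+1 1; IJumpLt tmp_reg tmp_reg.+1 l].

Definition test_code a b l :=
  let ca := comp_expr a tmp_reg in
  let cb := comp_expr b tmp_reg.+1 in
  ca.1 ++ cb.1 ++ [:: IJumpLt ca.2 cb.2 l].

(** Jump targets are absolute, so [comp] must know the lengths of the blocks that it jumps over. *)
Fixpoint csz (c : cmd) : nat :=
  match c with
  | Skip => 0
  | Asg _ e => esz e + 1
  | Sto _ a b => esz a + esz b + 6
  | Seq c d => csz c + csz d
  | If a b c d => (esz a + esz b + 1) + csz d + 3 + csz c
  | While _ a b c => (esz a + esz b + 1) + 3 + csz c + 3
  end.

(** No instruction copies a register; the conjunction of a register with itself does it in [Asg].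
    The test jumps when it succeeds, so the else branch of [If] comes first, and in [While] the exit
    jump precedes the body. *)
Fixpoint comp (c : cmd) (p : nat) : seq instr :=
  match c with
  | Skip => [::]
  | Asg x e =>
      let ce := comp_expr e tmp_reg in ce.1 ++ [:: IOp OAnd x ce.2 ce.2]
  | Sto t a b =>
      let ca := comp_expr a tmp_reg in
      let cb := comp_expr b tmp_reg.+1 in
      ca.1 ++ cb.1 ++ addr_code tmp_reg.+2 ca.2 t ++ [:: IStore tmp_reg.+2 cb.2]
  | Seq c d => comp c p ++ comp d (p + csz c)
  | If a b c d =>
      let q := p + (esz a + esz b + 1) in
      test_code a b (q + csz d + 3) ++ comp d q
      ++ jump_code (q + csz d + 3 + csz c) ++ comp c (q + csz d + 3)
  | While _ a b c =>
      let q := p + (esz a + esz b + 1) in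
      test_code a b (q + 3) ++ jump_code (q + 3 + csz c + 3)
      ++ comp c (q + 3) ++ jump_code p
  end.

Lemma size_comp_expr e d : size (comp_expr e d).1 = esz e.
Proof.
by elim: e d => //= [a ha b hb|a ha b hb|a ha b hb|a ha|t a ha] d;
   rewrite !size_cat ?ha ?hb /=; lia.
Qed.

Lemma size_comp c p : size (comp c p) = csz c.
Proof.
elim: c p => //= [x e|t a b|c hc d hd|a b c hc d hd|_ a b c hc] p;
  rewrite /test_code ?size_cat ?size_comp_expr ?hc ?hd /=
     ?size_cat ?hc /=; lia.
Qed.

(** * Operational semantics and correctness of the compiler *)

Section Semantics.

Variables (w L : nat) (inp : nat -> nat).
Local Notation W := (2 ^ w).

Fixpoint eval (s : store) (e : expr) : nat :=
  match e with
  | Var x => reg s x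
  | Cst c => c
  | Add a b => eval s a + eval s b
  | Sub a b => eval s a - eval s b
  | Mul a b => eval s a * eval s b
  | Inp a => inp (eval s a)
  | Arr t a => arr s t (eval s a)
  end.

(** These conditions make arithmetic modulo [2 ^ w] agree with arithmetic on [nat]: no overflow, no
    negative difference, and addresses that fit in a word. *)
Fixpoint safe (s : store) (e : expr) : Prop :=
  match e with
  | Var _ => True
  | Cst c => c < W
  | Add a b => [/\ safe s a, safe s b & eval s a + eval s b < W]
  | Sub a b => [/\ safe s a, safe s b & eval s b <= eval s a]
  | Mul a b => [/\ safe s a, safe s b & eval s a * eval s b < W]
  | Inp a => safe s a /\ eval s a < L
  | Arr t a => safe s a /\ L + 3 * eval s a + 3 < W
  end.

Inductive exec : cmd -> store -> store -> nat -> Prop :=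
  | ExSkip s : exec Skip s s 0
  | ExAsg x e s : safe s e -> exec (Asg x e) s (setr s x (eval s e)) (esz e + 1)
  | ExSto t a b s :
      safe s a -> safe s b -> L + 3 * eval s a + 3 < W ->
      exec (Sto t a b) s (seta s t (eval s a) (eval s b)) (esz a + esz b + 6)
  | ExSeq c d s s1 s2 t1 t2 :
      exec c s s1 t1 -> exec d s1 s2 t2 -> exec (Seq c d) s s2 (t1 + t2)
  | ExIfT a b c d s s1 t :
      safe s a -> safe s b -> eval s a < eval s b -> exec c s s1 t ->
      exec (If a b c d) s s1 ((esz a + esz b + 1) + t)
  | ExIfF a b c d s s1 t :
      safe s a -> safe s b -> (eval s a < eval s b) = false -> exec d s s1 t ->
      exec (If a b c d) s s1 ((esz a + esz b + 1) + (t + 3))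
  | ExWhileT l a b c s s1 s2 t1 t2 :
      safe s a -> safe s b -> eval s a < eval s b -> exec c s s1 t1 ->
      exec (While l a b c) s1 s2 t2 ->
      exec (While l a b c) s s2 ((esz a + esz b + 1) + (t1 + (3 + t2)))
  | ExWhileF l a b c s :
      safe s a -> safe s b -> (eval s a < eval s b) = false ->
      exec (While l a b c) s s ((esz a + esz b + 1) + 3).

(* The input occupies [0, L); entry i of array t is the cell L + 3 i + t. *)
Definition sim (s : store) (r m : nat -> nat) : Prop :=
  [/\ forall x, x < base_reg -> r x = reg s x /\ reg s x < W,
      r base_reg = L,
      forall i, i < L -> m i = inp i /\ inp i < W &
      forall t i, t < 3 -> m (L + 3 * i + t) = arr s t i /\ arr s t i < W].

Definition code_at (P c : seq instr) p :=
  forall i, i < size c -> nth (IHalt false) P (p + i) = nth (IHalt false) c i.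

Lemma code_at_cat P c d p :
  code_at P (c ++ d) p -> code_at P c p /\ code_at P d (p + size c).
Proof.
move=> h; split=> i hi.
  by rewrite h ?size_cat ?nth_cat ?hi //; lia.
have := h (size c + i); rewrite size_cat nth_cat addnA => ->; last by lia.
by rewrite ifF; [congr nth; lia | lia].
Qed.

Lemma code_at_cons P i c p :
  code_at P (i :: c) p -> nth (IHalt false) P p = i /\ code_at P c p.+1.
Proof.
move=> h; split; first by have := h 0 isT; rewrite addn0.
by move=> j hj; have := h j.+1 hj; rewrite addnS -addSn.
Qed.

Variable P : program.
Local Notation steps t := (iter t (step w P)).

Lemma steps_trans t1 t2 s1 s2 s3 :
  steps t1 s1 = s2 -> steps t2 s2 = s3 -> steps (t1 + t2) s1 = s3.
Proof. by move=> <- <-; rewrite addnC iterD. Qed.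

Lemma step1 p r m i :
  nth (IHalt false) P p = i ->
  step w P (State p r m) =
  match i with
  | IConst d c => State p.+1 (update r d (c %% W)) m
  | IOp o d a b => State p.+1 (update r d (eval_op w o (r a) (r b))) m
  | ILoad d a => State p.+1 (update r d (m (r a))) m
  | IStore a b => State p.+1 r (update m (r a) (r b))
  | IJumpLt a b l => State (if r a < r b then l else p.+1) r m
  | IHalt _ => State p r m
  end.
Proof. by move=> <-. Qed.

Lemma sim_tmp s r r' m :
  (forall x, x < tmp_reg -> r' x = r x) -> sim s r m -> sim s r' m.
Proof.
move=> e [h1 h2 h3 h4]; split=> //; last by rewrite e.
by move=> x hx; rewrite e; [apply: h1 | apply: leq_trans hx _].
Qed.

Lemma updE (f : nat -> nat) i x : update f i x i = x.
Proof. by rewrite /update eqxx. Qed.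

Lemma updN (f : nat -> nat) i x j : j != i -> update f i x j = f j.
Proof. by rewrite /update => /negbTE ->. Qed.

Lemma addr_codeP r m d i t p v :
  code_at P (addr_code d i t) p ->
  i <= d -> tmp_reg <= d -> r base_reg = L -> r i = v -> t < 3 ->
  L + 3 * v + 3 < W ->
  exists r', [/\ steps 5 (State p r m) = State (p + 5) r' m,
                 forall x, x < d -> r' x = r x & r' d = L + 3 * v + t].
Proof.
move=> /code_at_cons[h1] /code_at_cons[h2] /code_at_cons[h3]
  /code_at_cons[h4] /code_at_cons[h5 _] id td hb hi ht hW.
eexists; split.
- rewrite iterSr (step1 _ _ h1) iterSr (step1 _ _ h2) iterSr (step1 _ _ h3).
  by rewrite iterSr (step1 _ _ h4) iterSr (step1 _ _ h5) !addnS addn0.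
- by move=> x xd; rewrite !updN //; lia.
have N1 : (d == d.+1) = false by lia.
have N2 : (i == d.+1) = false by lia.
have N3 : (base_reg == d) = false by move: td; rewrite /tmp_reg /base_reg; lia.
have N4 : (base_reg == d.+1) = false by move: td; rewrite /tmp_reg /base_reg; lia.
have E3 : 3 %% W = 3 by apply: modn_small; lia.
have Et : t %% W = t by apply: modn_small; lia.
rewrite /update !eqxx ?N1 ?N2 ?N3 ?N4 ?eqxx ?N1 ?N3 ?N4 hb hi E3 Et /eval_op.
rewrite (@modn_small (v * 3)); last by lia.
by rewrite (@modn_small (_ + L)) ?modn_small; lia.
Qed.

Lemma comp_exprP s r m e d p :
  code_at P (comp_expr e d).1 p -> wfe e -> safe s e -> sim s r m ->
  tmp_reg <= d ->
  exists r',
    [/\ steps (esz e) (State p r m) = State (p + esz e) r' m,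
        forall x, x < d -> r' x = r x,
        (comp_expr e d).2 <= d,
        (comp_expr e d).2 < base_reg \/ (comp_expr e d).2 = d &
        r' (comp_expr e d).2 = eval s e /\ eval s e < W].
Proof.
have binP o a b f d' p' r' :
    (forall d p r,
       code_at P (comp_expr a d).1 p -> safe s a -> sim s r m -> tmp_reg <= d ->
       exists r', [/\ steps (esz a) (State p r m) = State (p + esz a) r' m,
        forall x, x < d -> r' x = r x,
        (comp_expr a d).2 <= d,
        (comp_expr a d).2 < base_reg \/ (comp_expr a d).2 = d &
        r' (comp_expr a d).2 = eval s a /\ eval s a < W]) ->
    (forall d p r,
       code_at P (comp_expr b d).1 p -> safe s b -> sim s r m -> tmp_reg <= d ->
       exists r', [/\ steps (esz b) (State p r m) = State (p + esz b) r' m,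
        forall x, x < d -> r' x = r x,
        (comp_expr b d).2 <= d,
        (comp_expr b d).2 < base_reg \/ (comp_expr b d).2 = d &
        r' (comp_expr b d).2 = eval s b /\ eval s b < W]) ->
    safe s a -> safe s b -> sim s r' m -> tmp_reg <= d' -> 0 < W ->
    eval_op w o (eval s a) (eval s b) = f ->
    code_at P ((comp_expr a d').1 ++ (comp_expr b d'.+1).1 ++
      [:: IOp o d' (comp_expr a d').2 (comp_expr b d'.+1).2]) p' ->
    exists r'', [/\ steps (esz a + esz b + 1) (State p' r' m) =
         State (p' + (esz a + esz b + 1)) r'' m,
        forall x, x < d' -> r'' x = r' x, d' <= d',
        d' < base_reg \/ d' = d' & r'' d' = f /\ f < W].
  move=> Ha Hb sa sb R td W0 fE.
  move=> /code_at_cat[hc1 /code_at_cat[hc2 /code_at_cons[hc3 _]]].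
  have [r1 [S1 E1 la ca [va lva]]] := Ha _ _ _ hc1 sa R td.
  rewrite size_comp_expr in hc2 hc3.
  have R1 : sim s r1 m.
    by apply: sim_tmp R => x hx; apply: E1; apply: leq_trans hx td.
  have [r2 [S2 E2 lb cb [vb lvb]]] := Hb _ _ _ hc2 sb R1 (leqW td).
  rewrite size_comp_expr in hc3.
  exists (update r2 d' f); split=> //.
  - rewrite -!addnA; apply: (steps_trans S1); apply: (steps_trans S2).
    rewrite iterSr (step1 _ _ hc3) vb E2 ?ltnS // va fE.
    by rewrite !addnA addn1.
  - by move=> x hx; rewrite updN ?E2 ?E1 //; lia.
  - by right.
  - by rewrite updE -fE /eval_op; split=> //; apply: ltn_pmod.
elim: e d p r => [x|c|a ha b hb|a ha b hb|a ha b hb|a ha|t a ha] d p r.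
- move=> _ /= hx _ R td; exists r; rewrite addn0; split=> //.
  + by apply: leq_trans (ltnW hx) _; apply: leq_trans td.
  + by left.
  + by case: R => /(_ x hx)[].
- move=> /code_at_cons[h _] _ hc R td.
  exists (update r d c); split=> //.
  + by change (esz (Cst c)) with 1; rewrite iterSr (step1 _ _ h) modn_small // addn1.
  + by move=> x hx; rewrite updN //; lia.
  + by right.
  + by rewrite updE.
- move=> hc /= /andP[wa wb] [sa sb sW] R td; apply: binP hc => //.
  + by move=> *; apply: ha.
  + by move=> *; apply: hb.
  + by lia.
  + by rewrite /eval_op modn_small.
- move=> hc /= /andP[wa wb] [sa sb sW] R td.
  have W0 : 0 < W by rewrite expn_gt0.
  (* [OSub] computes the difference plus [2 ^ w]; reduction recovers the difference because the
     minuend is a word, which the induction hypothesis provides. *)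
  have [] := ha d p r _ wa sa R td.
    by move: hc => /= /code_at_cat[].
  move=> _ [_ _ _ _ [_ lva]].
  apply: binP hc => //.
  + by move=> *; apply: ha.
  + by move=> *; apply: hb.
  + rewrite /eval_op -addnBAC // modnDr modn_small //; lia.
- move=> hc /= /andP[wa wb] [sa sb sW] R td; apply: binP hc => //.
  + by move=> *; apply: ha.
  + by move=> *; apply: hb.
  + by lia.
  + by rewrite /eval_op modn_small.
- move=> /= /code_at_cat[h1 /code_at_cons[h2 _]] wa [sa lt] R td.
  have [r1 [S1 E1 la ca [va lva]]] := ha _ _ _ h1 wa sa R td.
  rewrite size_comp_expr in h2.
  have [_ _ /(_ _ lt)[mi miW] _] := R.
  exists (update r1 d (inp (eval s a))); split=> //.
  + apply: (steps_trans S1); rewrite iterSr (step1 _ _ h2) va.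
    by rewrite mi addnA addn1.
  + by move=> x hx; rewrite updN ?E1 //; lia.
  + by right.
  + by rewrite updE.
- move=> /= /code_at_cat[h1 /(@code_at_cat _ (addr_code _ _ _))[h2 /code_at_cons[h3 _]]] /andP[ht wa] [sa lt] R td.
  have [r1 [S1 E1 la ca [va lva]]] := ha _ _ _ h1 wa sa R td.
  rewrite size_comp_expr in h2 h3.
  have R1 : sim s r1 m.
    by apply: sim_tmp R => x hx; apply: E1; apply: leq_trans hx td.
  have [_ rb _ R4] := R1; have {R4} [mi miW] := R4 t (eval s a) ht.
  have [r2 [S2 E2 v2]] := addr_codeP m h2 la td rb va ht lt.
  exists (update r2 d (arr s t (eval s a))); split=> //.
  + rewrite [esz a + 6]/(esz a + (5 + 1)).
    apply: (steps_trans S1); apply: (steps_trans S2).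
    by rewrite iterSr (step1 _ _ h3) v2 mi /=; congr State; lia.
  + by move=> x hx; rewrite updN ?E2 ?E1 //; lia.
  + by right.
  + by rewrite updE.
Qed.

Lemma test_codeP s r m a b l p :
  code_at P (test_code a b l) p -> wfe a -> wfe b -> safe s a -> safe s b ->
  sim s r m ->
  exists2 r', sim s r' m & steps (esz a + esz b + 1) (State p r m) =
    State (if eval s a < eval s b then l else p + (esz a + esz b + 1)) r' m.
Proof.
move=> /code_at_cat[h1 /code_at_cat[h2 /code_at_cons[h3 _]]] wa wb sa sb R.
have [r1 [S1 E1 la ca [va _]]] := comp_exprP h1 wa sa R (leqnn _).
rewrite size_comp_expr in h2 h3.
have R1 := sim_tmp E1 R.
have [r2 [S2 E2 lb cb [vb _]]] := comp_exprP h2 wb sb R1 (leqnSn _).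
rewrite size_comp_expr in h3.
exists r2; first by apply: sim_tmp R1 => x hx; apply: E2; apply: leqW.
rewrite -!addnA; apply: (steps_trans S1); apply: (steps_trans S2).
rewrite iterSr (step1 _ _ h3) vb E2 ?ltnS // va !addnA addn1.
by [].
Qed.

(** [1 < W] keeps the constant 1 from being truncated to 0, which would make the jump fall
    through. *)
Lemma jump_codeP s r m l p :
  code_at P (jump_code l) p -> 1 < W -> sim s r m ->
  exists2 r', sim s r' m & steps 3 (State p r m) = State l r' m.
Proof.
move=> /code_at_cons[h1] /code_at_cons[h2] /code_at_cons[h3 _] hW R; eexists; last first.
  rewrite iterSr (step1 _ _ h1) iterSr (step1 _ _ h2) iterSr (step1 _ _ h3).
  rewrite !(updE, updN) // mod0n modn_small //=.
by apply: sim_tmp R => x hx; rewrite !updN //; lia.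
Qed.

Lemma sim_setr s r m x v :
  sim s r m -> x < base_reg -> v < W -> sim (setr s x v) (update r x v) m.
Proof.
move=> [h1 h2 h3 h4] hx hv; split=> //.
  by move=> y hy; rewrite /= /update; case: eqP => // _; apply: h1.
by rewrite updN //; apply/eqP => e; rewrite e ltnn in hx.
Qed.

(** The address [L + 3 * i + t] with [t < 3] determines [i] and [t] and lies behind the input, so a
    write changes a single array entry. *)
Lemma sim_seta s r m t i v :
  sim s r m -> t < 3 -> v < W ->
  sim (seta s t i v) r (update m (L + 3 * i + t) v).
Proof.
move=> [h1 h2 h3 h4] ht hv; split=> //.
  by move=> j hj; rewrite updN; [apply: h3 | lia].
move=> t' i' ht' /=.
have [e|ne] := eqVneq (L + 3 * i' + t') (L + 3 * i + t).
  have [-> ->] : t' = t /\ i' = i by lia.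
  by rewrite updE eqxx updE.
rewrite updN //; case: eqP => [et|_]; last exact: h4.
rewrite updN -?et; first exact: h4.
by apply: contraNneq ne => ->; rewrite et.
Qed.

Theorem comp_correct c s s' t : exec c s s' t ->
  forall p r m, code_at P (comp c p) p -> wfc c -> sim s r m -> 1 < W ->
  exists r' m', steps t (State p r m) = State (p + csz c) r' m' /\ sim s' r' m'.
Proof.
elim=> {c s s' t}.
- by move=> s p r m _ _ R _; exists r, m; rewrite addn0.
- move=> x e s sf p r m /= /code_at_cat[h1 /code_at_cons[h2 _]] /andP[wx we] R W1.
  have [r1 [S1 E1 l1 c1 [v1 lv1]]] := comp_exprP h1 we sf R (leqnn _).
  rewrite size_comp_expr in h2.
  exists (update r1 x (eval s e)), m; split; last first.
    exact: sim_setr (sim_tmp E1 R) wx lv1.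
  apply: (steps_trans S1); rewrite iterSr (step1 _ _ h2) v1.
  by rewrite /eval_op PeanoNat.Nat.land_diag modn_small // addnA addn1.
- move=> t a b s sa sb hW p r m /=.
  move=> /code_at_cat[h1 /code_at_cat[h2]] /(@code_at_cat _ (addr_code _ _ _))[h3 /code_at_cons[h4 _]].
  move=> /and3P[ht wa wb] R W1.
  have [r1 [S1 E1 la ca [va lva]]] := comp_exprP h1 wa sa R (leqnn _).
  rewrite !size_comp_expr in h2 h3 h4.
  have R1 := sim_tmp E1 R.
  have [r2 [S2 E2 lb cb [vb lvb]]] := comp_exprP h2 wb sb R1 (leqnSn _).
  have R2 : sim s r2 m by apply: sim_tmp R1 => x hx; apply: E2; apply: leqW.
  have va2 : r2 (comp_expr a tmp_reg).2 = eval s a by rewrite E2 ?ltnS.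
  have [_ rb _ _] := R2.
  have [r3 [S3 E3 v3]] := addr_codeP m h3 (leqW (leqW la)) isT rb va2 ht hW.
  exists r3, (update m (L + 3 * eval s a + t) (eval s b)); split; last first.
    apply: sim_seta => //; apply: sim_tmp R2 => x hx; apply: E3.
    by apply: leqW; apply: leqW.
  have -> : esz a + esz b + 6 = esz a + (esz b + (5 + 1)) by lia.
  rewrite (steps_trans S1 (steps_trans S2 (steps_trans S3 (erefl _)))).
  by rewrite iterSr (step1 _ _ h4) v3 E3 ?vb //=; congr State; lia.
- move=> c d s s1 s2 t1 t2 _ Hc _ Hd p r m /= /code_at_cat[h1 h2] /andP[wc wd] R W1.
  have [r1 [m1 [S1 R1]]] := Hc _ _ _ h1 wc R W1.
  rewrite size_comp in h2.
  have [r2 [m2 [S2 R2]]] := Hd _ _ _ h2 wd R1 W1.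
  by exists r2, m2; split=> //; rewrite (steps_trans S1 S2) addnA.
- move=> a b c d s s1 t sa sb lt _ Hc p r m /=.
  move=> /code_at_cat[h1 /code_at_cat[h2]] /(@code_at_cat _ (jump_code _))[h3 h4].
  move=> /and4P[wa wb wc wd] R W1.
  have [r1 R1 S1] := test_codeP h1 wa wb sa sb R; rewrite lt in S1.
  have sz : size (test_code a b (p + (esz a + esz b + 1) + csz d + 3)) = esz a + esz b + 1.
    by rewrite !size_cat !size_comp_expr /=; lia.
  rewrite sz size_comp in h2 h3 h4.
  have [r2 [m2 [S2 R2]]] := Hc _ _ _ h4 wc R1 W1.
  by exists r2, m2; split=> //; rewrite (steps_trans S1 S2); congr State; lia.
- move=> a b c d s s1 t sa sb lt _ Hd p r m /=.
  move=> /code_at_cat[h1 /code_at_cat[h2]] /(@code_at_cat _ (jump_code _))[h3 h4].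
  move=> /and4P[wa wb wc wd] R W1.
  have [r1 R1 S1] := test_codeP h1 wa wb sa sb R; rewrite lt in S1.
  have sz : size (test_code a b (p + (esz a + esz b + 1) + csz d + 3)) = esz a + esz b + 1.
    by rewrite !size_cat !size_comp_expr /=; lia.
  rewrite sz size_comp in h2 h3 h4.
  have [r2 [m2 [S2 R2]]] := Hd _ _ _ h2 wd R1 W1.
  have [r3 R3 S3] := jump_codeP h3 W1 R2.
  exists r3, m2; split=> //; rewrite (steps_trans S1 (steps_trans S2 S3)).
  by congr State; lia.
- move=> l a b c s s1 s2 t1 t2 sa sb lt _ Hc _ Hw p r m /= hcode.
  move: (hcode) => /code_at_cat[h1 /(@code_at_cat _ (jump_code _))[h2]] /code_at_cat[h3 h4].
  move=> /and3P[wa wb wc] R W1.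
  have [r1 R1 S1] := test_codeP h1 wa wb sa sb R; rewrite lt in S1.
  have sz : size (test_code a b (p + (esz a + esz b + 1) + 3)) = esz a + esz b + 1.
    by rewrite !size_cat !size_comp_expr /=; lia.
  rewrite sz ?size_comp in h2 h3 h4.
  have [r2 [m2 [S2 R2]]] := Hc _ _ _ h3 wc R1 W1.
  have [r3 R3 S3] := jump_codeP h4 W1 R2.
  have [|r4 [m4 [S4 R4]]] := Hw p r3 m2 hcode _ R3 W1.
    by rewrite /= wa wb wc.
  exists r4, m4; split=> //.
  rewrite (steps_trans S1 (steps_trans S2 (steps_trans S3 S4))) /=.
  by congr State; lia.
- move=> l a b c s sa sb lt p r m /=.
  move=> /code_at_cat[h1 /(@code_at_cat _ (jump_code _))[h2]] /code_at_cat[h3 h4].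
  move=> /and3P[wa wb wc] R W1.
  have [r1 R1 S1] := test_codeP h1 wa wb sa sb R; rewrite lt in S1.
  have sz : size (test_code a b (p + (esz a + esz b + 1) + 3)) = esz a + esz b + 1.
    by rewrite !size_cat !size_comp_expr /=; lia.
  rewrite sz ?size_comp in h2 h3 h4.
  have [r3 R3 S3] := jump_codeP h2 W1 R1.
  exists r3, m; split=> //; rewrite (steps_trans S1 S3).
  by congr State; lia.
Qed.

End Semantics.

(** * Weakest preconditions with a time bound *)

Fixpoint mods (c : cmd) : seq nat :=
  match c with
  | Asg x _ => [:: x]
  | Seq c d | If _ _ c d => mods c ++ mods d
  | While _ _ _ c => mods c
  | _ => [::]
  end.

Fixpoint amods (c : cmd) : seq nat :=
  match c with
  | Sto t _ _ => [:: t]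
  | Seq c d | If _ _ c d => amods c ++ amods d
  | While _ _ _ c => amods c
  | _ => [::]
  end.

Definition For l x e c :=
  Seq (Asg x (Cst 0)) (While l (Var x) e (Seq c (Asg x (Add (Var x) (Cst 1))))).

(** Only a strict test is available; equality is the failure of both strict orders, at the price of
    compiling [d] twice. *)
Definition IfEq a b c d := If a b d (If b a d c).

Definition frame (xs ts : seq nat) (s s' : store) :=
  (forall x, x \notin xs -> reg s' x = reg s x) /\
  (forall t, t \notin ts -> arr s' t = arr s t).

Section Wp.

Variables (w L : nat) (inp : nat -> nat) (bd : nat -> nat).
Local Notation W := (2 ^ w).
Local Notation exec := (exec w L inp).
Local Notation eval := (eval inp).
Local Notation safe := (safe w L inp).

(* [bd l] bounds the number of iterations of each loop labelled [l]. *)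
Fixpoint cost (c : cmd) : nat :=
  match c with
  | Skip => 0
  | Asg _ e => esz e + 1
  | Sto _ a b => esz a + esz b + 6
  | Seq c d => cost c + cost d
  | If a b c d => esz a + esz b + 4 + cost c + cost d
  | While l a b c =>
      bd l * (esz a + esz b + 4 + cost c) + (esz a + esz b + 4)
  end.

(** Total correctness within time [cost c], which depends on the text of [c] and on [bd] but not on
    the store. Timing the program thus reduces to bounding one explicit expression. *)
Definition wp c s (Q : store -> Prop) :=
  exists s' t, [/\ exec c s s' t, t <= cost c & Q s'].

Lemma exec_frame c s s' t : exec c s s' t -> frame (mods c) (amods c) s s'.
Proof.
elim=> {c s s' t} //=.
- by move=> x e s _; split=> // y; rewrite inE => /negbTE ny; rewrite /= /update ny.
- by move=> t a b s _ _ _; split=> // u; rewrite inE => /negbTE ny /=; rewrite ny.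
- move=> c d s s1 s2 t1 t2 _ [h1 h2] _ [h3 h4].
  by split=> x; rewrite mem_cat negb_or => /andP[? ?]; rewrite ?h3 ?h4 ?h1 ?h2.
- move=> a b c d s s1 t _ _ _ _ [h1 h2].
  by split=> x; rewrite mem_cat negb_or => /andP[? ?]; rewrite ?h1 ?h2.
- move=> a b c d s s1 t _ _ _ _ [h1 h2].
  by split=> x; rewrite mem_cat negb_or => /andP[? ?]; rewrite ?h1 ?h2.
- move=> l a b c s s1 s2 t1 t2 _ _ _ _ [h1 h2] _ [h3 h4].
  by split=> x nx; rewrite ?h3 ?h4 ?h1 ?h2.
Qed.

Lemma wp_frame c s Q :
  wp c s Q -> wp c s (fun s' => frame (mods c) (amods c) s s' /\ Q s').
Proof.
by move=> [s' [t [e le q]]]; exists s', t; split=> //; split=> //; apply: exec_frame e.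
Qed.

Lemma wp_mono c s (Q Q' : store -> Prop) :
  wp c s Q -> (forall s', frame (mods c) (amods c) s s' -> Q s' -> Q' s') ->
  wp c s Q'.
Proof.
move=> /wp_frame[s' [t [e le [f q]]]] h.
by exists s', t; split=> //; apply: h.
Qed.

Lemma wp_skip s (Q : store -> Prop) : Q s -> wp Skip s Q.
Proof. by exists s, 0; split=> //; constructor. Qed.

Lemma wp_asg x e s (Q : store -> Prop) :
  safe s e -> Q (setr s x (eval s e)) -> wp (Asg x e) s Q.
Proof. by move=> h q; eexists; exists (esz e + 1); split; [constructor|..]. Qed.

Lemma wp_sto t a b s (Q : store -> Prop) :
  safe s a -> safe s b -> L + 3 * eval s a + 3 < W ->
  Q (seta s t (eval s a) (eval s b)) -> wp (Sto t a b) s Q.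
Proof.
by move=> h1 h2 h3 q; eexists; exists (esz a + esz b + 6); split; [constructor|..].
Qed.

Lemma wp_seq c d s Q :
  wp c s (fun s' => wp d s' Q) -> wp (Seq c d) s Q.
Proof.
move=> [s1 [t1 [e1 l1 [s2 [t2 [e2 l2 q]]]]]].
exists s2, (t1 + t2); split=> //=; [exact: ExSeq e1 e2 | exact: leq_add].
Qed.

Lemma wp_if a b c d s Q :
  safe s a -> safe s b ->
  (eval s a < eval s b -> wp c s Q) ->
  (eval s b <= eval s a -> wp d s Q) ->
  wp (If a b c d) s Q.
Proof.
move=> sa sb hc hd; case: (ltnP (eval s a) (eval s b)) => h.
  have [s' [t [e l q]]] := hc h; eexists; eexists; split; last exact: q.
    by apply: ExIfT e.
  by move=> /=; lia.
have [s' [t [e l q]]] := hd h; eexists; eexists; split; last exact: q.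
  by apply: ExIfF e => //; apply/negbTE; rewrite -leqNgt.
by move=> /=; lia.
Qed.

Lemma wp_ifeq a b c d s Q :
  safe s a -> safe s b ->
  (eval s a = eval s b -> wp c s Q) ->
  (eval s a != eval s b -> wp d s Q) ->
  wp (IfEq a b c d) s Q.
Proof.
move=> sa sb hc hd; apply: wp_if => // h1.
  by apply: hd; rewrite neq_ltn h1.
apply: wp_if => // h2; first by apply: hd; rewrite neq_ltn h2 orbT.
by apply: hc; apply/eqP; rewrite eqn_leq h1 h2.
Qed.

(** Every loop of the algorithm runs a number [N] of rounds known beforehand, so the count of
    finished rounds both indexes the invariant and gives termination. *)
Lemma wp_while l a b c s N (J : nat -> store -> Prop) :
  N <= bd l -> J 0 s ->
  (forall i s', i <= N -> frame (mods c) (amods c) s s' -> J i s' ->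
     [/\ safe s' a, safe s' b & (eval s' a < eval s' b) = (i < N)]) ->
  (forall i s', i < N -> frame (mods c) (amods c) s s' -> J i s' ->
     wp c s' (J i.+1)) ->
  wp (While l a b c) s (J N).
Proof.
move=> lN J0 hab hc.
have frs s' : forall s1, frame (mods c) (amods c) s s' ->
    frame (mods c) (amods c) s' s1 -> frame (mods c) (amods c) s s1.
  by move=> s1 [f1 f2] [f3 f4]; split=> x nx; rewrite ?f3 ?f4 ?f1 ?f2.
suff H j : forall i s', i + j = N -> frame (mods c) (amods c) s s' -> J i s' ->
    exists s1 t, [/\ exec (While l a b c) s' s1 t,
      t <= j * (esz a + esz b + 4 + cost c) + (esz a + esz b + 4) & J N s1].
  have [s1 [t [e le q]]] := H N 0 s (erefl _) (conj (fun _ _ => erefl) (fun _ _ => erefl)) J0.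
  exists s1, t; split=> //=; apply: leq_trans le _.
  by rewrite leq_add2r leq_mul2r lN orbT.
elim: j => [|j IH] i s' hi f Ji.
  have [sa sb cmp] := hab i s' ltac:(lia) f Ji.
  exists s', (esz a + esz b + 1 + 3); split; last by rewrite -hi addn0.
    by apply: ExWhileF => //; rewrite cmp; lia.
  by lia.
have [sa sb cmp] := hab i s' ltac:(lia) f Ji.
have iN : i < N by lia.
have [s1 [t1 [e1 l1 [f1 J1]]]] := wp_frame (hc i s' iN f Ji).
have [s2 [t2 [e2 l2 q]]] := IH i.+1 s1 ltac:(lia) (frs _ _ f f1) J1.
eexists; eexists; split; last exact: q.
  by apply: ExWhileT e1 e2 => //; rewrite cmp.
by rewrite mulSn; lia.
Qed.

(** The limit [e] is evaluated anew in each round, so it must keep the value [N] in every store that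
    the loop can reach. *)
Lemma wp_for l x e c s N (J : nat -> store -> Prop) (Q : store -> Prop) :
  x \notin mods c -> N <= bd l -> N < W -> 1 < W ->
  (forall s', frame (x :: mods c) (amods c) s s' -> safe s' e /\ eval s' e = N) ->
  J 0 (setr s x 0) ->
  (forall i s', i < N -> frame (x :: mods c) (amods c) s s' -> reg s' x = i ->
     J i s' -> wp c s' (fun s'' => J i.+1 (setr s'' x i.+1))) ->
  (forall s', frame (x :: mods c) (amods c) s s' -> J N s' -> Q s') ->
  wp (For l x e c) s Q.
Proof.
move=> nx lN NW W1 he J0 hc hQ.
have frs s' : frame (mods (Seq c (Asg x (Add (Var x) (Cst 1)))))
    (amods (Seq c (Asg x (Add (Var x) (Cst 1))))) (setr s x 0) s' ->
    frame (x :: mods c) (amods c) s s'.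
  move=> [f1 f2]; split=> y; rewrite ?inE ?negb_or.
    move=> /andP[ny nc]; rewrite f1 /= ?mem_cat ?inE ?negb_or ?ny ?nc //.
    by rewrite /update (negbTE ny).
  by move=> nc; rewrite f2 //= cats0.
apply: wp_seq; apply: wp_asg => /=; first lia.
apply: (@wp_mono _ _ (fun s' => reg s' x = N /\ J N s')); last first.
  move=> s' f [_ hJ]; apply: hQ => //; exact: frs.
apply: (@wp_while _ _ _ _ _ N (fun i s' => reg s' x = i /\ J i s')) => //.
- by rewrite /= /update eqxx.
- move=> i s' iN /frs f [xi Ji]; have [se ee] := he s' f.
  by split=> //; rewrite ee /= xi.
- move=> i s' iN /frs f [xi Ji]; apply: wp_seq.
  apply: wp_mono (hc i s' iN f xi Ji) _ => s'' [fx _] J'.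
  have xi' : reg s'' x = i by rewrite fx.
  by apply: wp_asg; rewrite /= xi' ?addn1; [split=> //; lia | rewrite /update eqxx].
Qed.

End Wp.
(** * The algorithm *)

(* [r_K] holds k + 1, not k. *)
Local Notation r_n := 0 (only parsing).
Local Notation r_K := 1 (only parsing).
Local Notation r_h := 2 (only parsing).
Local Notation r_cost := 3 (only parsing).
Local Notation r_count := 4 (only parsing).
Local Notation r_v := 5 (only parsing).
Local Notation r_j := 6 (only parsing).
Local Notation r_t := 7 (only parsing).
Local Notation r_D := 8 (only parsing).
Local Notation r_size := 9 (only parsing).
Local Notation r_in := 10 (only parsing).
Local Notation r_out := 11 (only parsing).
Local Notation r_thr := 12 (only parsing).
Local Notation r_found := 13 (only parsing).
Local Notation r_res := 14 (only parsing).
Local Notation r_done := 15 (only parsing).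
Local Notation r_pos := 16 (only parsing).
Local Notation r_lab := 17 (only parsing).
Local Notation r_mism := 18 (only parsing).
Local Notation r_e := 19 (only parsing).
Local Notation r_i := 20 (only parsing).
Local Notation r_carry := 21 (only parsing).
Local Notation a_digit := 0 (only parsing).
Local Notation a_lab := 1 (only parsing).
Local Notation a_wt := 2 (only parsing).
Local Notation l_n := 0 (only parsing).
Local Notation l_K := 1 (only parsing).
Local Notation l_thr := 2 (only parsing).
Local Notation l_all := 3 (only parsing).

Definition Incr x e := Asg x (Add (Var x) e).

(** Pointer [v] is cell [v + 3]; a degree is the difference of two consecutive pointers, obtained in
    constant time. *)
Definition degE := Sub (Inp (Add (Var r_v) (Cst 4))) (Inp (Add (Var r_v) (Cst 3))).

Definition excess_cmd :=
  For l_K r_j (Var r_K) (For l_K r_t (Var r_K)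
    (Seq (Asg r_count (Cst 0))
    (Seq (For l_n r_v (Var r_n)
           (IfEq (Arr a_lab (Var r_v)) (Var r_j)
              (If (Var r_t) (Arr a_wt (Var r_v)) (Incr r_count (Cst 1)) Skip) Skip))
         (If (Var r_h) (Var r_count) (Incr r_cost (Sub (Var r_count) (Var r_h))) Skip)))).

(** The loop carries the label [l_K] because it is run only at vertices below the threshold, whose
    neighbours are all among the at most [k + 1] clique vertices. *)
Definition mism_cmd :=
  Seq (Asg r_mism (Cst 0))
      (For l_K r_e degE
         (IfEq (Arr a_lab (Inp (Add (Inp (Add (Var r_v) (Cst 3))) (Var r_e)))) (Var r_lab)
            Skip (Incr r_mism (Cst 1)))).

Definition clique_cmd :=
  For l_n r_v (Var r_n)
    (If degE (Var r_thr) Skip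
      (Seq (Asg r_lab (Arr a_digit (Var r_pos)))
      (Seq (For l_K r_i (Var r_pos)
              (IfEq (Arr a_digit (Var r_i)) (Var r_lab) Skip (Incr r_cost (Cst 1))))
      (Seq (Sto a_lab (Var r_v) (Var r_lab))
      (Seq (Sto a_wt (Var r_v) (Var r_K))
           (Incr r_pos (Cst 1))))))).

(** A vertex that sees two labels and has a neighbour with its guessed label gets weight [K], not
    its degree: isolating it is the business of another guess. *)
Definition rest_cmd :=
  For l_n r_v (Var r_n)
    (If degE (Var r_thr)
      (If degE (Cst 1)
        (Seq (Sto a_lab (Var r_v) (Cst 0)) (Sto a_wt (Var r_v) (Cst 0)))
        (Seq (Asg r_lab (Arr a_lab (Inp (Inp (Add (Var r_v) (Cst 3))))))
        (Seq mism_cmd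
             (If (Var r_mism) (Cst 1)
                (Seq (Sto a_lab (Var r_v) (Var r_lab)) (Sto a_wt (Var r_v) degE))
                (Seq (Asg r_lab (Arr a_digit (Var r_pos)))
                (Seq (Incr r_pos (Cst 1))
                (Seq mism_cmd
                (Seq (Incr r_cost (Var r_mism))
                (Seq (Sto a_lab (Var r_v) (Var r_lab))
                     (If (Var r_mism) degE
                        (Sto a_wt (Var r_v) (Var r_K))
                        (Sto a_wt (Var r_v) (Cst 0)))))))))))
      ) Skip).

Definition leaf_cmd :=
  Seq (Asg r_cost (Cst 0)) (Seq (Asg r_pos (Cst 0))
  (Seq clique_cmd (Seq rest_cmd excess_cmd))).

Definition accept_cmd := If (Var r_cost) (Var r_K) (Asg r_res (Cst 1)) Skip.

Definition next_cmd :=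
  Seq (Asg r_carry (Cst 1))
  (Seq (For l_K r_i (Sub (Var r_K) (Cst 1))
         (If (Cst 0) (Var r_carry)
            (IfEq (Arr a_digit (Add (Var r_i) (Cst 1))) (Sub (Var r_K) (Cst 1))
               (Sto a_digit (Add (Var r_i) (Cst 1)) (Cst 0))
               (Seq (Sto a_digit (Add (Var r_i) (Cst 1))
                       (Add (Arr a_digit (Add (Var r_i) (Cst 1))) (Cst 1)))
                    (Asg r_carry (Cst 0))))
            Skip))
       (Asg r_done (Var r_carry))).

Definition search_cmd :=
  While l_all (Var r_done) (Cst 1) (Seq leaf_cmd (Seq accept_cmd next_cmd)).

(** A candidate is judged by degree sums alone, so no neighbour list is read. *)
Definition threshold_cmd :=
  For l_thr r_D (Add (Var r_K) (Cst 2))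
    (Seq (Asg r_size (Cst 0)) (Seq (Asg r_in (Cst 0)) (Seq (Asg r_out (Cst 0))
    (Seq (For l_n r_v (Var r_n)
            (If degE (Var r_D) (Incr r_out degE)
               (Seq (Incr r_in degE) (Incr r_size (Cst 1)))))
         (IfEq (Add (Var r_in) (Var r_size)) (Add (Var r_out) (Mul (Var r_size) (Var r_size)))
            (If (Var r_size) (Add (Var r_K) (Cst 1))
               (Seq (Asg r_thr (Var r_D)) (Asg r_found (Cst 1))) Skip)
            Skip))))).

Definition degree_cmd := For l_n r_v (Var r_n) (Sto a_wt (Var r_v) degE).

(** The degree test comes first, while the label array is still blank, so that [excess_cmd] sees a
    single class. The digit array is blank too, which is the guess of number 0. *)
Definition main_cmd :=
  Seq (Asg r_n (Inp (Cst 0)))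
  (Seq (Asg r_K (Add (Inp (Cst 1)) (Cst 1)))
  (Seq (Asg r_h (Inp (Cst 2)))
  (Seq degree_cmd
  (Seq excess_cmd
  (Seq accept_cmd
  (Seq threshold_cmd
       (If (Cst 0) (Var r_found) search_cmd Skip))))))).

(* Iterations over: vertices; labels, levels or neighbours; thresholds; guesses. *)
Definition bounds n k l :=
  nth 0 [:: n; k.+1; k.+3; k.+1 ^ k] l.

Ltac frw f := repeat match goal with
  | |- context [reg ?s ?x] => rewrite (proj1 f x isT)
  | |- context [arr ?s ?x] => rewrite (proj2 f x isT)
  end.

Lemma sum_ord_le m b (F : nat -> nat) :
  (forall i, F i <= b) -> \sum_(i < m) F i <= m * b.
Proof.
move=> h; rewrite -[m in m * b]card_ord -sum_nat_const.
by apply: leq_sum => i _.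
Qed.

(** * The quantities that the program computes *)

Section Spec.

Variables (n k h : nat) (nb : nat -> seq nat).
Local Notation K := k.+1.
Implicit Types (lab wt a : nat -> nat).

Definition deg v := size (nb v).

Definition level lab wt j t := \sum_(v < n) ((lab v == j) && (t < wt v) : nat).

(* Layer-cake formula for the least weight, cut off at K per vertex, whose removal
   leaves at most h vertices in each class of [lab]. *)
Definition excess lab wt := \sum_(j < K) \sum_(t < K) (level lab wt j t - h).

Definition thr_size D := \sum_(v < n) (D <= deg v : nat).
Definition thr_in D := \sum_(v < n) (if D <= deg v then deg v else 0).
Definition thr_out D := \sum_(v < n) (if D <= deg v then 0 else deg v).
Definition thr_ok D :=
  (thr_in D + thr_size D == thr_out D + thr_size D * thr_size D) &&
  (thr_size D <= K).

Variable D : nat.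

(* [a] lists the guessed labels: those of the vertices of degree at least D, in
   increasing order, then those of the [multi] vertices.  Weight K makes a vertex
   too expensive to be removed; weight 0 is for a vertex that has lost all its
   edges already. *)
Definition rk v := \sum_(u < v) (D <= deg u : nat).

Definition mism (l : nat -> nat) v c := count (fun y => l y != c) (nb v).

Definition clab a v := a (rk v).

Definition first_lab a v := clab a (head 0 (nb v)).

Definition multi a v :=
  [&& deg v < D, 0 < deg v & 0 < mism (clab a) v (first_lab a v)].

Definition qk a v := rk n + \sum_(u < v) (multi a u : nat).

Definition lab a v :=
  if D <= deg v then clab a v
  else if deg v == 0 then 0
  else if multi a v then a (qk a v) else first_lab a v.

Definition wt a v :=
  if D <= deg v then K
  else if multi a v then
    (if mism (clab a) v (a (qk a v)) < deg v then K else 0)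
  else deg v.

(** Any two clique vertices are adjacent, so unequal labels mean a cut edge; it is charged to the
    later vertex. *)
Definition pair_cost a v :=
  if D <= deg v then \sum_(i < rk v) (a i != a (rk v) : nat) else 0.

Definition multi_cost a v :=
  if multi a v then mism (clab a) v (a (qk a v)) else 0.

Definition leaf a :=
  \sum_(v < n) pair_cost a v + \sum_(v < n) multi_cost a v +
  excess (lab a) (wt a).

(* Digit 0 is constantly 0: the first clique vertex may be given label 0. *)
Definition digit x i := if i is i'.+1 then (x %/ K ^ i') %% K else 0.

End Spec.

Arguments digit : simpl never.

(** * Verification of the program against these quantities *)

Section Verify.

Variables (n k h w L : nat) (nb : nat -> seq nat) (inp : nat -> nat).
Local Notation K := k.+1.
Local Notation W := (2 ^ w).
Local Notation deg := (deg nb).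
Local Notation wp := (wp w L inp (bounds n k)).

Hypothesis inp_n : inp 0 = n.
Hypothesis inp_k : inp 1 = k.
Hypothesis inp_h : inp 2 = h.
Hypothesis inp_ptr : forall v, v < n -> inp (v + 4) = inp (v + 3) + deg v.
Hypothesis inp_nb : forall v e, v < n -> e < deg v ->
  inp (inp (v + 3) + e) = nth 0 (nb v) e.
Hypothesis inp_len : forall v, v < n -> inp (v + 3) + deg v <= L.
Hypothesis L_n : n + 4 <= L.
Hypothesis nb_lt : forall v e, v < n -> e < deg v -> nth 0 (nb v) e < n.
Hypothesis deg_le : forall v, v < n -> deg v <= n.
(** This makes addresses and counters fit in a word. [W_cost] does the same for costs: [n * K]
    bounds those inside the clique, [n * n] those of the vertices that see two labels, and
    [K * (K * n)] the excess; the two squares also cover the threshold equation. *)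
Hypothesis W_lin : L + 6 * n + 6 * k + 6 * h + 30 < W.
Hypothesis W_cost : n * K + n * n + n * n + K * (K * n) + n < W.

Definition consts s := [/\ reg s r_n = n, reg s r_K = K & reg s r_h = h].

Lemma consts_frame xs ts s s' :
  frame xs ts s s' -> [&& r_n \notin xs, r_K \notin xs & r_h \notin xs] ->
  consts s -> consts s'.
Proof. by move=> [f _] /and3P[? ? ?] [h1 h2 h3]; split; rewrite f. Qed.

Lemma safe_degE s v : reg s r_v = v -> v < n -> safe w L inp s degE.
Proof.
by move=> e vn; rewrite /= e inp_ptr //; split; (do ?split); lia.
Qed.

Lemma eval_degE s v : reg s r_v = v -> v < n -> eval inp s degE = deg v.
Proof. by move=> e vn; rewrite /= e inp_ptr //; lia. Qed.

Lemma level_cmdP s lab wt j t :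
  consts s -> reg s r_j = j -> reg s r_t = t -> reg s r_count = 0 ->
  (forall v, v < n -> arr s a_lab v = lab v) ->
  (forall v, v < n -> arr s a_wt v = wt v) ->
  wp (For l_n r_v (Var r_n)
           (IfEq (Arr a_lab (Var r_v)) (Var r_j)
              (If (Var r_t) (Arr a_wt (Var r_v)) (Incr r_count (Cst 1)) Skip) Skip)) s
     (fun s' => reg s' r_count = level n lab wt j t).
Proof.
move=> [cn ck ch] ej et ec hl hw.
apply: (@wp_for _ _ _ _ _ _ _ _ _ n
  (fun i s' => reg s' r_count = \sum_(v < i) ((lab v == j) && (t < wt v) : nat)));
  rewrite ?big_ord0 //; try lia.
- by move=> s' f /=; frw f.
- move=> i s' iN f ei ec'.
  have cntW : reg s' r_count + 1 < W.
    have := @sum_ord_le i 1 (fun v => (lab v == j) && (t < wt v)).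
    by rewrite ec' => /(_ (fun _ => leq_b1 _)); lia.
  apply: wp_ifeq => /=; rewrite ?ei; frw f; rewrite ?hl ?hw //; first (split; lia).
    rewrite ej => e1; apply: wp_if => /=; rewrite ?ei //; frw f; rewrite ?hw ?et //.
    + by split=> //; lia.
    + move=> lt; apply: wp_asg => /=; first by split=> //; lia.
      by rewrite big_ord_recr /= e1 eqxx lt /update /= -ec'.
    + move=> lt; apply: wp_skip; rewrite /= /update /= big_ord_recr /=.
      by rewrite ec' ltnNge lt andbF addn0.
  rewrite ej => ne; apply: wp_skip.
  by rewrite /= /update /= big_ord_recr /= (negbTE ne) addn0.
Qed.

Lemma level_le lab wt j t : level n lab wt j t <= n.
Proof.
have := @sum_ord_le n 1 (fun v => (lab v == j) && (t < wt v)).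
by rewrite muln1; apply=> i; apply: leq_b1.
Qed.

Lemma excess_cmdP s lab wt c :
  consts s -> reg s r_cost = c -> c + K * (K * n) < W ->
  (forall v, v < n -> arr s a_lab v = lab v) ->
  (forall v, v < n -> arr s a_wt v = wt v) ->
  wp excess_cmd s (fun s' => reg s' r_cost = c + excess n k h lab wt).
Proof.
move=> cs ec cW hl hw.
have F1 j t : level n lab wt j t - h <= n.
  by apply: leq_trans (level_le lab wt j t); apply: leq_subr.
have F2 j i : \sum_(t < i) (level n lab wt j t - h) <= i * n.
  by apply: (@sum_ord_le i n (fun t => level n lab wt j t - h)).
have F3 i : \sum_(j < i) \sum_(t < K) (level n lab wt j t - h) <= i * (K * n).
  by apply: (@sum_ord_le i _ (fun j => \sum_(t < K) (level n lab wt j t - h))).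
have [cn ck ch] := cs.
apply: (@wp_for _ _ _ _ _ _ _ _ _ K (fun i s' =>
  reg s' r_cost = c + \sum_(j < i) \sum_(t < K) (level n lab wt j t - h)));
  rewrite ?big_ord0 ?addn0 //; try lia.
- by move=> s' f /=; frw f.
move=> i s' iN f ei ec'.
apply: (@wp_for _ _ _ _ _ _ _ _ _ K (fun m s'' =>
  reg s'' r_cost = c + \sum_(j < i) \sum_(t < K) (level n lab wt j t - h)
   + \sum_(t < m) (level n lab wt i t - h)));
  rewrite ?big_ord0 ?addn0 //; try lia.
- by move=> s'' f' /=; frw f'; frw f.
- move=> m s'' mN f' em ec''.
  apply: wp_seq; apply: wp_asg => /=; first lia.
  apply: wp_seq.
  apply: (@wp_mono _ _ _ _ _ _ (fun s0 => reg s0 r_count = level n lab wt i m)).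
    apply: level_cmdP => //=; rewrite /update /= ?em //; frw f'; frw f => //.
    by split=> /=; rewrite /update /=; frw f'; frw f.
  move=> s0 f0 ecnt.
  have eh0 : reg s0 r_h = h by frw f0; rewrite /= /update /=; frw f'; frw f.
  have ec0 : reg s0 r_cost = reg s'' r_cost by frw f0.
  apply: wp_if => //=; rewrite ?ecnt ?eh0.
    move=> lt; apply: wp_asg; rewrite /= ecnt ec0 eh0.
      rewrite ec''; split=> //; first by split=> //; lia.
      have := F1 i m; have := F2 i m; have := F3 i.
      have h1 : i * (K * n) + K * n <= K * (K * n) by rewrite addnC -mulSn leq_mul2r iN orbT.
      have h2 : m * n + n <= K * n by rewrite addnC -mulSn leq_mul2r mN orbT.
      lia.
    by rewrite /update /= ec'' big_ord_recr /= addnA.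
  move=> le; apply: wp_skip; rewrite /= /update /= ec0 ec''.
  by rewrite big_ord_recr /=; lia.
- by move=> s'' f' ec''; rewrite /= /update /= ec'' [in RHS]big_ord_recr /= addnA.
Qed.

Lemma mism_cmdP s v c (l : nat -> nat) :
  reg s r_v = v -> v < n -> reg s r_lab = c -> deg v <= K ->
  {in nb v, forall y, arr s a_lab y = l y} ->
  wp mism_cmd s (fun s' => reg s' r_mism = mism nb l v c).
Proof.
move=> ev vn ec dK hl; apply: wp_seq; apply: wp_asg => /=; first lia.
have dn := deg_le vn.
apply: (@wp_for _ _ _ _ _ _ _ _ _ (deg v) (fun i s' =>
  reg s' r_mism = count (fun y => l y != c) (take i (nb v))));
  rewrite ?take0 //; try lia.
- move=> s' f; have ev' : reg s' r_v = v by frw f.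
  by split; [apply: safe_degE ev' vn | apply: eval_degE ev' vn].
- move=> i s' iN f ei ec'.
  have ev' : reg s' r_v = v by frw f.
  have ecL : reg s' r_lab = c by frw f.
  have hin : nth 0 (nb v) i \in nb v by apply: mem_nth.
  have hl' : arr s' a_lab (nth 0 (nb v) i) = l (nth 0 (nb v) i).
    by frw f; apply: hl.
  have cW : reg s' r_mism <= n.
    rewrite ec'; apply: leq_trans (count_size _ _) _.
    by rewrite size_take iN; lia.
  have lt := nb_lt vn iN.
  have hp := inp_len vn.
  have stake : take i.+1 (nb v) = rcons (take i (nb v)) (nth 0 (nb v) i).
    by apply: take_nth.
  apply: wp_ifeq => /=; rewrite ?ev' ?ei ?inp_nb ?ecL ?hl' //.
  + by do ?split; lia.
  + move=> e; apply: wp_skip.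
    by rewrite /= /update /= stake -cats1 count_cat /= e eqxx ec'; lia.
  + move=> ne; apply: wp_asg => /=; first by do ?split; lia.
    by rewrite /update /= stake -cats1 count_cat /= ne ec'.
- by move=> s' f ->; rewrite take_size.
Qed.

Lemma rk_le D v : rk nb D v <= v.
Proof.
have := @sum_ord_le v 1 (fun u => D <= deg u).
by rewrite muln1; apply=> i; apply: leq_b1.
Qed.

Lemma rk_mono D u v : u <= v -> rk nb D u <= rk nb D v.
Proof.
elim: v => [|v IH]; first by rewrite leqn0 => /eqP ->.
rewrite leq_eqVlt => /orP[/eqP -> //|]; rewrite ltnS => /IH le.
by rewrite {2}/rk big_ord_recr; apply: leq_trans le (leq_addr _ _).
Qed.

Lemma clique_cmdP s D a :
  consts s -> reg s r_thr = D -> reg s r_pos = 0 -> reg s r_cost = 0 ->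
  arr s a_digit =1 a -> thr_size n nb D <= K ->
  wp clique_cmd s (fun s' =>
    [/\ reg s' r_pos = rk nb D n, reg s' r_cost = \sum_(v < n) pair_cost nb D a v &
        forall v, v < n -> D <= deg v ->
          arr s' a_lab v = clab nb D a v /\ arr s' a_wt v = K]).
Proof.
move=> cs eD eP eC ea sK.
have [cn ck ch] := cs.
have rkS i : rk nb D i.+1 = rk nb D i + (D <= deg i) by rewrite /rk big_ord_recr.
have pc v : v < n -> pair_cost nb D a v <= K.
  move=> vn; rewrite /pair_cost; case: ifP => // _.
  apply: leq_trans (@sum_ord_le (rk nb D v) 1 (fun i => a i != a (rk nb D v)) _) _.
    by move=> i; apply: leq_b1.
  by rewrite muln1; apply: leq_trans sK; apply: rk_mono (ltnW vn).
have pcs i : i <= n -> \sum_(v < i) pair_cost nb D a v <= i * K.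
  move=> iN; rewrite -[i in i * _]card_ord -sum_nat_const; apply: leq_sum => v _.
  by apply: pc; apply: leq_trans iN.
apply: (@wp_for _ _ _ _ _ _ _ _ _ n (fun i s' =>
    [/\ reg s' r_pos = rk nb D i, reg s' r_cost = \sum_(v < i) pair_cost nb D a v &
        forall v, v < i -> D <= deg v ->
          arr s' a_lab v = clab nb D a v /\ arr s' a_wt v = K]));
  rewrite ?big_ord0 //; try lia.
- by move=> s' f /=; frw f.
- by split=> //=; rewrite /rk big_ord0.
- move=> i s' iN f ei [eP' eC' hv].
  have eD' : reg s' r_thr = D by frw f.
  have eK' : reg s' r_K = K by frw f.
  have ea' j : arr s' a_digit j = a j by frw f.
  have rn : rk nb D i <= n by apply: leq_trans (rk_le D i) (ltnW iN).
  apply: wp_if; [exact: safe_degE ei iN | by [] | |];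
    rewrite (eval_degE ei iN) /= eD' => cmp.
    have pc0 : pair_cost nb D a i = 0 by rewrite /pair_cost leqNgt cmp.
    apply: wp_skip => /=; rewrite /update /= eP' eC' rkS leqNgt cmp addn0.
    split=> //; first by rewrite big_ord_recr /= pc0 addn0.
    move=> v.
    rewrite ltnS leq_eqVlt => /orP[/eqP -> |]; [by rewrite leqNgt cmp | exact: hv].
  apply: wp_seq; apply: wp_asg => /=; first by rewrite eP'; split=> //; lia.
  rewrite eP' ea'; apply: wp_seq.
  (* This is the iteration bound charged to the inner loop over the earlier digits. *)
  have rK : rk nb D i <= K by apply: leq_trans sK; apply: rk_mono (ltnW iN).
  set s1 := setr _ _ _.
  apply: (@wp_mono _ _ _ _ _ _ (fun s2 => reg s2 r_cost =
     \sum_(v < i) pair_cost nb D a v + \sum_(j < rk nb D i) (a j != a (rk nb D i)))).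
    apply: (@wp_for _ _ _ _ _ _ _ _ _ (rk nb D i) (fun m s2 => reg s2 r_cost =
     \sum_(v < i) pair_cost nb D a v + \sum_(j < m) (a j != a (rk nb D i))));
     rewrite ?big_ord0 ?addn0 //; try lia.
    + by move=> s2 f2 /=; frw f2; rewrite /= /update /=.
    + move=> m s2 mN f2 em ec2.
      have eL2 : reg s2 r_lab = a (rk nb D i) by frw f2.
      have ea2 : arr s2 a_digit m = a m by frw f2; rewrite /= ea'.
      apply: wp_ifeq => /=; rewrite ?em ?ea2 ?eL2 //; first by split=> //; lia.
        move=> e; apply: wp_skip; rewrite /= /update /= ec2.
        by rewrite big_ord_recr /= e eqxx addn0.
      move=> ne; apply: wp_asg; rewrite /= ?ec2.
        do ?split; first lia.
        have h1 := pcs i (ltnW iN).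
        have h2 : \sum_(j < m) (a j != a (rk nb D i)) <= m.
          apply: leq_trans (@sum_ord_le m 1 (fun j => a j != a (rk nb D i)) _) _.
            by move=> ?; apply: leq_b1.
          by rewrite muln1.
        have h3 : i * K + K <= n * K by rewrite addnC -mulSn leq_mul2r iN orbT.
        lia.
      by rewrite /update /= [in RHS]big_ord_recr /= ne addnA.
  move=> s2 f2 ec2.
  have ei2 : reg s2 r_v = i by frw f2; rewrite /= /update /=.
  have eL2 : reg s2 r_lab = a (rk nb D i) by frw f2; rewrite /= /update /=.
  have eK2 : reg s2 r_K = K by frw f2; rewrite /= /update /=.
  have eP2 : reg s2 r_pos = rk nb D i by frw f2; rewrite /= /update /=.
  apply: wp_seq; apply: wp_sto => //=; first by rewrite ei2; lia.
  apply: wp_seq; apply: wp_sto => //=; first by rewrite ei2; lia.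
  apply: wp_asg => /=; first by do ?split; rewrite ?eP2; lia.
  rewrite /update /= ei2 eL2 eK2 eP2 ec2 rkS cmp addn1; split=> //.
    by rewrite [in RHS]big_ord_recr /= [in RHS]/pair_cost cmp.
  move=> v; rewrite ltnS leq_eqVlt => /orP[/eqP ->|vi] dv; first by rewrite eqxx.
  by rewrite (ltn_eqF vi); frw f2; apply: hv.
Qed.

Lemma rest_cmdP s D a :
  consts s -> reg s r_thr = D -> reg s r_pos = rk nb D n ->
  reg s r_cost = \sum_(v < n) pair_cost nb D a v ->
  arr s a_digit =1 a -> thr_size n nb D <= K ->
  (forall v, v < n -> D <= deg v ->
      arr s a_lab v = clab nb D a v /\ arr s a_wt v = K) ->
  (forall v, v < n -> deg v < D ->
      deg v <= K /\ {in nb v, forall y, D <= deg y}) ->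
  wp rest_cmd s (fun s' =>
    [/\ reg s' r_cost = \sum_(v < n) pair_cost nb D a v +
                       \sum_(v < n) multi_cost n nb D a v,
        forall v, v < n -> arr s' a_lab v = lab n nb D a v &
        forall v, v < n -> arr s' a_wt v = wt n k nb D a v]).
Proof.
move=> cs eD eP eC ea sK hcl hout.
have [cn ck ch] := cs.
have pcs : \sum_(v < n) pair_cost nb D a v <= n * K.
  rewrite -[n in n * _]card_ord -sum_nat_const; apply: leq_sum => v _.
  rewrite /pair_cost; case: ifP => // _.
  apply: leq_trans (@sum_ord_le (rk nb D v) 1 (fun i => a i != a (rk nb D v)) _) _.
    by move=> i; apply: leq_b1.
  by rewrite muln1; apply: leq_trans sK; apply: rk_mono (ltnW _).
have mis v c : v < n -> mism nb (clab nb D a) v c <= n.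
  move=> vn; apply: leq_trans (count_size _ _) _; exact: deg_le.
have mcs i : i <= n -> \sum_(v < i) multi_cost n nb D a v <= i * n.
  move=> iN; rewrite -[i in i * _]card_ord -sum_nat_const; apply: leq_sum => v _.
  by rewrite /multi_cost; case: ifP => // _; apply: mis; apply: leq_trans iN.
have qkS i : qk n nb D a i.+1 = qk n nb D a i + multi nb D a i.
  by rewrite /qk big_ord_recr addnA.
have qk_le i : qk n nb D a i <= n + i.
  rewrite /qk leq_add ?rk_le //.
  have := @sum_ord_le i 1 (fun u => multi nb D a u).
  by rewrite muln1; apply=> j; apply: leq_b1.
apply: (@wp_for _ _ _ _ _ _ _ _ _ n (fun i s' =>
    [/\ reg s' r_pos = qk n nb D a i,
        reg s' r_cost = \sum_(v < n) pair_cost nb D a v +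
                       \sum_(v < i) multi_cost n nb D a v,
        forall v, v < n -> D <= deg v ->
          arr s' a_lab v = clab nb D a v /\ arr s' a_wt v = K &
        forall v, v < i ->
          arr s' a_lab v = lab n nb D a v /\ arr s' a_wt v = wt n k nb D a v]));
  rewrite ?big_ord0 //; try lia.
- by move=> s' f /=; frw f.
- by split=> //=; rewrite /update /= ?eP ?eC /qk ?big_ord0 ?addn0.
- move=> i s' iN f ei [eP' eC' hc hv].
  have eD' : reg s' r_thr = D by frw f.
  have eK' : reg s' r_K = K by frw f.
  have ea' j : arr s' a_digit j = a j by frw f.
  apply: wp_if; [exact: safe_degE ei iN | by [] | |];
    rewrite (eval_degE ei iN) /= eD' => cmp; last first.
    have m0 : multi nb D a i = false by rewrite /multi ltnNge cmp.
    have mc0 : multi_cost n nb D a i = 0 by rewrite /multi_cost m0.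
    apply: wp_skip => /=; rewrite /update /= eP' eC' qkS m0 addn0.
    split=> //; first by rewrite [in RHS]big_ord_recr /= mc0 addn0.
    move=> v.
    rewrite ltnS leq_eqVlt => /orP[/eqP ->|]; last exact: hv.
    by rewrite /lab /wt cmp; apply: hc.
  have Dd : (D <= deg i) = false by rewrite leqNgt cmp.
  have [dK hnb] := hout i iN cmp.
  (* All neighbours of [i] are clique vertices, so the labels read here are never overwritten by
     this loop. *)
  have hcl' s1 : arr s1 a_lab = arr s' a_lab -> {in nb i, forall y, arr s1 a_lab y = clab nb D a y}.
    move=> -> y yi; have := hnb y yi; have := nthP 0 yi => -[e le <-] hD.
    by have [-> _] := hc _ (nb_lt iN le) hD.
  (* Each of the four branches writes one label and one weight at [i]; only the values remain to be
     checked. *)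
  have fin s1 :
      reg s1 r_pos = qk n nb D a i + multi nb D a i ->
      reg s1 r_cost = \sum_(v < n) pair_cost nb D a v +
        \sum_(v < i) multi_cost n nb D a v + multi_cost n nb D a i ->
      arr s1 a_lab = update (arr s' a_lab) i (lab n nb D a i) ->
      arr s1 a_wt = update (arr s' a_wt) i (wt n k nb D a i) ->
      [/\ reg s1 r_pos = qk n nb D a i.+1,
        reg s1 r_cost = \sum_(v < n) pair_cost nb D a v +
                       \sum_(v < i.+1) multi_cost n nb D a v,
        forall v, v < n -> D <= deg v ->
          arr s1 a_lab v = clab nb D a v /\ arr s1 a_wt v = K &
        forall v, v < i.+1 ->
          arr s1 a_lab v = lab n nb D a v /\ arr s1 a_wt v = wt n k nb D a v].
    move=> -> -> -> ->; split; rewrite ?qkS //.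
    + by rewrite [in RHS]big_ord_recr addnA.
    + move=> v vn dv; rewrite /update; case: eqP => [vi|_]; last exact: hc.
      by rewrite vi Dd in dv.
    + move=> v; rewrite ltnS leq_eqVlt => /orP[/eqP ->|vi]; rewrite /update ?eqxx //.
      by rewrite (ltn_eqF vi); apply: hv.
  apply: wp_if; [exact: safe_degE ei iN | by move=> /=; lia | |];
    rewrite (eval_degE ei iN) /= => d0.
    have {}d0 : deg i = 0 by lia.
    have m0 : multi nb D a i = false by rewrite /multi d0 andbF.
    apply: wp_seq; apply: wp_sto => //; [by rewrite /= ?ei; lia .. |].
    apply: wp_sto => //; [by rewrite /= ?ei; lia .. |].
    apply: fin; rewrite /= ?eP' ?eC' ?m0 ?addn0 ?ei //.
    + by rewrite /multi_cost m0 addn0.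
    + by rewrite /lab Dd d0.
    + by rewrite /wt Dd m0 d0.
  have e0 : inp (inp (i + 3)) = head 0 (nb i).
    by rewrite -nth0 -inp_nb ?addn0.
  have hd : head 0 (nb i) \in nb i by rewrite -nth0 mem_nth.
  have hdn : head 0 (nb i) < n by rewrite -nth0 nb_lt.
  have hp := inp_len iN.
  apply: wp_seq; apply: wp_asg => /=; rewrite ei ?e0; first by do ?split; lia.
  rewrite (hcl' s' erefl _ hd).
  apply: wp_seq; apply: wp_mono (@mism_cmdP _ i (first_lab nb D a i) (clab nb D a) _ _ _ _ _) _ => //.
    exact: hcl'.
  move=> s1 f1 eC1.
  have ei1 : reg s1 r_v = i by frw f1; rewrite /= /update /=.
  have eP1 : reg s1 r_pos = qk n nb D a i by frw f1; rewrite /= /update /=.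
  have eK1 : reg s1 r_K = K by frw f1; rewrite /= /update /=.
  have eL1 : reg s1 r_lab = first_lab nb D a i by frw f1; rewrite /= /update /=.
  have ec1 : reg s1 r_cost = reg s' r_cost by frw f1; rewrite /= /update /=.
  have ea1 t : arr s1 t = arr s' t by case: f1 => _ ->.
  apply: wp_if => //=; rewrite ?eC1; first lia.
    move=> m1; have m0 : multi nb D a i = false.
      by rewrite /multi cmp d0 lt0n; case: (mism _ _ _ _) m1.
    apply: wp_seq; apply: wp_sto => //; first by rewrite /= ei1; lia.
    apply: wp_sto; [by [] | exact: (safe_degE (v := i)) | by rewrite /= ei1; lia |].
    rewrite (eval_degE (v := i)) //.
    apply: fin; rewrite /= ?eP1 ?ec1 ?eC' ?m0 ?addn0 ?ei1 ?eL1 ?ea1 //.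
    + by rewrite /multi_cost m0 addn0.
    + by rewrite /lab Dd m0 (gtn_eqF d0).
    + by rewrite /wt Dd m0.
  move=> m1; have mi : multi nb D a i by rewrite /multi cmp d0.
  have qn := qk_le i.
  apply: wp_seq; apply: wp_asg => /=; rewrite ?eP1 ?ea1 ?ea'; first by split=> //; lia.
  apply: wp_seq; apply: wp_asg => /=; rewrite /update /= ?eP1; first by do ?split=> //; lia.
  apply: wp_seq.
  apply: wp_mono (@mism_cmdP _ i (a (qk n nb D a i)) (clab nb D a) _ _ _ _ _) _ => //.
    by apply: hcl'; rewrite /= ea1.
  move=> s2 f2 eC2.
  have ei2 : reg s2 r_v = i by frw f2; rewrite /= /update /=.
  have eP2 : reg s2 r_pos = qk n nb D a i + 1 by frw f2; rewrite /= /update /= ?eP1.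
  have eK2 : reg s2 r_K = K by frw f2; rewrite /= /update /=.
  have eL2 : reg s2 r_lab = a (qk n nb D a i) by frw f2; rewrite /= /update /= ?eP1.
  have ec2 : reg s2 r_cost = reg s' r_cost by frw f2; rewrite /= /update /=.
  have ea2 t : arr s2 t = arr s' t by case: f2 => _ ->; rewrite //= ea1.
  have mi_n := mis i (a (qk n nb D a i)) iN.
  apply: wp_seq; apply: wp_asg.
    rewrite /= ?ec2 ?eC2 ?eC'; do ?split=> //; have := mcs i (ltnW iN).
    have h3 : i * n + n <= n * n by rewrite addnC -mulSn leq_mul2r iN orbT.
    lia.
  apply: wp_seq; apply: wp_sto => //; first by rewrite /= /update /= ei2; lia.
  set s3 := seta _ _ _ _.
  have ei3 : reg s3 r_v = i by [].
  have lE : a (qk n nb D a i) = lab n nb D a i by rewrite /lab Dd mi (gtn_eqF d0).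
  have mE : mism nb (clab nb D a) i (a (qk n nb D a i)) = multi_cost n nb D a i.
    by rewrite /multi_cost mi.
  apply: wp_if; [by [] | exact: safe_degE ei3 iN | |];
    rewrite (eval_degE ei3 iN) [X in X -> _]/= {1}/update /= eC2 => cmp2.
    apply: wp_sto => //; first by rewrite /= /update /= ei2; lia.
    apply: fin; rewrite /= /update /= ?ei2 ?eK2 ?ea2 ?eP2 ?mi ?eL2 ?lE ?ec2 ?eC2 ?eC' ?mE //.
    by rewrite /wt Dd mi cmp2.
  apply: wp_sto => //; [by rewrite /=; lia | by rewrite /= /update /= ei2; lia |].
  apply: fin; rewrite /= /update /= ?ei2 ?eK2 ?ea2 ?eP2 ?mi ?eL2 ?lE ?ec2 ?eC2 ?eC' ?mE //.
  by rewrite /wt Dd mi ltnNge cmp2.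
- by move=> s' f [_ eC' _ hv]; split=> // v vn; have [] := hv v vn.
Qed.

Lemma leaf_cmdP s D a :
  consts s -> reg s r_thr = D -> arr s a_digit =1 a -> thr_size n nb D <= K ->
  (forall v, v < n -> deg v < D ->
      deg v <= K /\ {in nb v, forall y, D <= deg y}) ->
  wp leaf_cmd s (fun s' => reg s' r_cost = leaf n k h nb D a).
Proof.
move=> cs eD ea sK hout.
apply: wp_seq; apply: wp_asg => /=; first lia.
apply: wp_seq; apply: wp_asg => /=; first lia.
apply: wp_seq; apply: wp_mono (@clique_cmdP _ D a _ _ _ _ _ _) _ => //.
move=> s1 f1 [eP1 eC1 h1].
have cs1 : consts s1 by apply: consts_frame f1 _ _.
apply: wp_seq; apply: wp_mono (@rest_cmdP _ D a _ _ _ _ _ _ _ _) _ => //.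
- by frw f1.
- by move=> j; frw f1; apply: ea.
move=> s2 f2 [eC2 hl hw].
have cs2 : consts s2 by apply: consts_frame f2 _ _.
apply: wp_mono (excess_cmdP cs2 eC2 _ hl hw) _ => //.
have pcs : \sum_(v < n) pair_cost nb D a v <= n * K.
  rewrite -[n in n * _]card_ord -sum_nat_const; apply: leq_sum => v _.
  rewrite /pair_cost; case: ifP => // _.
  apply: leq_trans (@sum_ord_le (rk nb D v) 1 (fun i => a i != a (rk nb D v)) _) _.
    by move=> i; apply: leq_b1.
  by rewrite muln1; apply: leq_trans sK; apply: rk_mono (ltnW _).
have mcs : \sum_(v < n) multi_cost n nb D a v <= n * n.
  rewrite -[n in n * _]card_ord -sum_nat_const; apply: leq_sum => v _.
  rewrite /multi_cost; case: ifP => // _.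
  by apply: leq_trans (count_size _ _) _; exact: deg_le.
lia.
Qed.

Lemma dvdn_succ q : (K %| q.+1) = (q %% K == k).
Proof.
rewrite {1}(divn_eq q K) -addnS dvdn_addr ?dvdn_mull //.
have : q %% K <= k by rewrite -ltnS ltn_pmod.
rewrite leq_eqVlt => /orP[/eqP ->|lt]; first by rewrite dvdnn eqxx.
by rewrite gtnNdvd // (ltn_eqF lt).
Qed.

(** Divisibility of [x.+1] by [K ^ i] expresses that the increment carries into the digit of index
    [i.+1]; [dvdn_expS] says when the carry moves on. *)
Lemma digitS i x :
  digit k x.+1 i.+1 =
    if K ^ i %| x.+1 then
      if digit k x i.+1 == k then 0 else (digit k x i.+1).+1
    else digit k x i.+1.
Proof.
rewrite /digit divnS ?expn_gt0 //; case: ifP => // _; rewrite add1n modnS.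
by rewrite dvdn_succ.
Qed.

Lemma dvdn_expS i x :
  (K ^ i.+1 %| x.+1) = (K ^ i %| x.+1) && (digit k x i.+1 == k).
Proof.
rewrite /digit; case: (boolP (K ^ i %| x.+1)) => d; last first.
  apply: contraNF d; apply: dvdn_trans; exact: dvdn_exp2l.
rewrite -dvdn_succ.
have <- : x.+1 %/ K ^ i = (x %/ K ^ i).+1 by rewrite divnS ?expn_gt0 // d add1n.
by rewrite -{1}(divnK d) expnS dvdn_pmul2r // expn_gt0.
Qed.

Lemma digit_lt x i : digit k x i < K.
Proof. by case: i => // i; apply: ltn_pmod. Qed.

Lemma next_cmdP s x :
  consts s -> arr s a_digit =1 digit k x -> x < K ^ k ->
  wp next_cmd s (fun s' => reg s' r_done = (x.+1 == K ^ k) /\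
    (x.+1 < K ^ k -> arr s' a_digit =1 digit k x.+1)).
Proof.
move=> [cn ck ch] ea xK; apply: wp_seq; apply: wp_asg => /=; first lia.
apply: wp_seq.
apply: (@wp_for _ _ _ _ _ _ _ _ _ k (fun i s' =>
    reg s' r_carry = (K ^ i %| x.+1) /\
    forall j, arr s' a_digit j = if j <= i then digit k x.+1 j else digit k x j)).
- by [].
- by rewrite /= leqnSn.
- by lia.
- by lia.
- by move=> s' f /=; frw f; rewrite /= /update /= ck; split; [split=> //; lia | lia].
- by split=> [|[|j]] /=; rewrite ?dvd1n ?ea //.
- move=> i s' iK f ei [ec hd].
  have ek' : reg s' r_K = K by frw f.
  have edi : arr s' a_digit i.+1 = digit k x i.+1 by rewrite hd ltnn.
  have step s1 : reg s1 r_carry = (K ^ i.+1 %| x.+1) ->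
      arr s1 a_digit =1 update (arr s' a_digit) i.+1 (digit k x.+1 i.+1) ->
      update (reg s1) r_i i.+1 r_carry = (K ^ i.+1 %| x.+1) /\
      forall j, arr s1 a_digit j =
        if j <= i.+1 then digit k x.+1 j else digit k x j.
    move=> e1 e2; rewrite /= {1}/update /= e1; split=> // j.
    rewrite e2 /update; case: eqP => [->|/eqP ne]; first by rewrite leqnn.
    by rewrite hd [j <= i.+1]leq_eqVlt (negbTE ne).
  apply: wp_if => //=; first lia.
    move=> c0; have di : K ^ i %| x.+1 by move: c0; rewrite ec; case: (_ %| _).
    apply: wp_ifeq => /=; rewrite ?ei ?ek' ?addn1 ?subn1 ?edi /=.
    + by do ?split=> //; lia.
    + by do ?split=> //; lia.
    + move=> e; apply: wp_sto => //; [by rewrite /= ?ei; do ?split=> //; lia .. |].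
      apply: step; rewrite /= ?ei ?addn1 ?digitS ?dvdn_expS ?di ?e ?eqxx //.
      by rewrite ec di.
    + move=> ne; apply: wp_seq; apply: wp_sto.
      * by rewrite /= ei; do ?split=> //; lia.
      * have := digit_lt x i.+1; rewrite /= ?ei ?addn1 ?edi => ?.
        by do ?split=> //; lia.
      * by rewrite /= ei; lia.
      apply: wp_asg; first by rewrite /=; lia.
      apply: step; rewrite /= ?ei ?addn1 ?edi ?digitS ?dvdn_expS ?di ?(negbTE ne) //.
  move=> c0; have di : (K ^ i %| x.+1) = false by move: c0; rewrite ec; case: (_ %| _).
  apply: wp_skip; apply: step.
  + by rewrite ec dvdn_expS di.
  + by move=> j; rewrite digitS di /update; case: eqP => // ->.
move=> s' f [ec hd]; apply: wp_asg => //=; rewrite /update /= ec; split.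
  congr nat_of_bool; apply/idP/eqP => [d|->]; last exact: dvdnn.
  by have := dvdn_leq (ltn0Sn x) d; lia.
(* Digits of index above [k] are left alone; they vanish for [x] and [x.+1], both below [K ^ k]. *)
move=> lt j; rewrite hd; case: leqP => // kj.
case: j kj => // j; rewrite ltnS /digit => kj.
have kK : K ^ k <= K ^ j by rewrite leq_pexp2l.
have lj := leq_trans lt kK.
by rewrite (divn_small lj) (divn_small (ltnW lj)).
Qed.

Lemma search_cmdP s D (r : bool) :
  consts s -> reg s r_thr = D -> arr s a_digit =1 digit k 0 -> reg s r_done = 0 ->
  reg s r_res = r -> thr_size n nb D <= K ->
  (forall v, v < n -> deg v < D ->
      deg v <= K /\ {in nb v, forall y, D <= deg y}) ->
  wp search_cmd s (fun s' => reg s' r_res =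
    r || has (fun x => leaf n k h nb D (digit k x) <= k) (iota 0 (K ^ k))).
Proof.
move=> cs eD ea e0 er sK hout.
apply: (@wp_mono _ _ _ _ _ _ (fun s' => 
   [/\ reg s' r_res =
         r || has (fun x => leaf n k h nb D (digit k x) <= k) (iota 0 (K ^ k)),
       reg s' r_done = (K ^ k == K ^ k) & (K ^ k < K ^ k -> arr s' a_digit =1 digit k (K ^ k))]));
  last by move=> s' _ [].
apply: (@wp_while _ _ _ _ _ _ _ _ _ (K ^ k) (fun i s' =>
   [/\ reg s' r_res =
         r || has (fun x => leaf n k h nb D (digit k x) <= k) (iota 0 i),
       reg s' r_done = (i == K ^ k) & (i < K ^ k -> arr s' a_digit =1 digit k i)])).
- by [].
- by rewrite orbF; split=> //; rewrite e0; case: eqP => //; have := expn_gt0 K k; lia.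
- move=> i s' iN f [_ ed _]; split=> //=; first lia.
  by rewrite ed [RHS]ltn_neqAle iN; case: eqP.
- move=> i s' iN f [er' ed eg].
  have cs' : consts s' by apply: consts_frame f _ cs.
  apply: wp_seq; apply: wp_mono (@leaf_cmdP _ D (digit k i) cs' _ (eg iN) sK hout) _.
    by frw f.
  move=> s1 f1 ec1.
  have cs1 : consts s1 by apply: consts_frame f1 _ cs'.
  have [_ ek1 _] := cs1.
  apply: wp_seq.
  apply: (@wp_mono _ _ _ _ _ _ (fun s2 => reg s2 r_res = 
     r || has (fun x => leaf n k h nb D (digit k x) <= k) (iota 0 i.+1))).
    have er1 : reg s1 r_res = reg s' r_res by frw f1.
    have es : has (fun x => leaf n k h nb D (digit k x) <= k) (iota 0 i.+1) =
       has (fun x => leaf n k h nb D (digit k x) <= k) (iota 0 i) ||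
       (leaf n k h nb D (digit k i) <= k).
      by rewrite -addn1 iotaD has_cat /= orbF.
    apply: wp_if => //; rewrite [X in X -> _]/= ec1 ek1 => cmp.
      apply: wp_asg; first by rewrite /=; lia.
      by rewrite es -ltnS cmp !orbT.
    by apply: wp_skip; rewrite er1 er' es (leqNgt _ k) cmp orbF.
  move=> s2 f2 er2.
  have cs2 : consts s2 by apply: consts_frame f2 _ cs1.
  apply: wp_mono (@next_cmdP _ i cs2 _ iN) _.
    by move=> j; frw f2; frw f1; apply: eg.
  by move=> s3 f3 [ed3 eg3]; split=> //; frw f3.
Qed.

Lemma threshold_cmdP s :
  consts s -> reg s r_found = 0 ->
  wp threshold_cmd s (fun s' =>
    (reg s' r_found = 1 /\ thr_ok n k nb (reg s' r_thr)) \/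
    (reg s' r_found = 0 /\ forall D, D < k.+3 -> ~~ thr_ok n k nb D)).
Proof.
move=> cs e0.
apply: (@wp_for _ _ _ _ _ _ _ _ _ k.+3 (fun i s' =>
    (reg s' r_found = 1 /\ thr_ok n k nb (reg s' r_thr)) \/
    (reg s' r_found = 0 /\ forall D, D < i -> ~~ thr_ok n k nb D))) => //.
- by lia.
- by lia.
- by move=> s' f; have [_ /= ek _] := consts_frame f isT cs; rewrite ek; split; [split=> //|]; lia.
- by right.
move=> i s' iN f ei J.
have [en ek _] := consts_frame f isT cs.
apply: wp_seq; apply: wp_asg => /=; first lia.
apply: wp_seq; apply: wp_asg => /=; first lia.
apply: wp_seq; apply: wp_asg => /=; first lia.
set s1 := setr _ _ _.
have ei1 : reg s1 r_D = i by [].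
have sumle m (F : nat -> nat) b : m <= n -> (forall v, v < n -> F v <= b) ->
    \sum_(v < m) F v <= m * b.
  move=> mn hF; rewrite -[m in m * _]card_ord -sum_nat_const; apply: leq_sum => v _.
  by apply: hF; apply: leq_trans mn.
have bS m : m <= n -> \sum_(v < m) (i <= deg v : nat) <= m * 1.
  by move=> mn; apply: (sumle m (fun v => i <= deg v)) => // v _; apply: leq_b1.
have bX m : m <= n -> \sum_(v < m) (if i <= deg v then deg v else 0) <= m * n.
  move=> mn; apply: (sumle m (fun v => if i <= deg v then deg v else 0)) => // v vn.
  by case: ifP => // _; apply: deg_le.
have bY m : m <= n -> \sum_(v < m) (if i <= deg v then 0 else deg v) <= m * n.
  move=> mn; apply: (sumle m (fun v => if i <= deg v then 0 else deg v)) => // v vn.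
  by case: ifP => // _; apply: deg_le.
apply: wp_seq.
apply: (@wp_mono _ _ _ _ _ _ (fun s2 => [/\ reg s2 r_size = thr_size n nb i,
   reg s2 r_in = thr_in n nb i & reg s2 r_out = thr_out n nb i])).
  apply: (@wp_for _ _ _ _ _ _ _ _ _ n (fun m s2 => 
    [/\ reg s2 r_size = \sum_(v < m) (i <= deg v : nat),
        reg s2 r_in = \sum_(v < m) (if i <= deg v then deg v else 0) &
        reg s2 r_out = \sum_(v < m) (if i <= deg v then 0 else deg v)])) => //.
  - by lia.
  - by lia.
  - by move=> s2 f2 /=; frw f2.
  - by rewrite !big_ord0.
  move=> m s2 mn f2 em [eS eX eY].
  have ei2 : reg s2 r_D = i by frw f2.
  have dm := deg_le mn.
  have mm : m * n + n <= n * n by rewrite addnC -mulSn leq_mul2r mn orbT.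
  have := bS m (ltnW mn); have := bX m (ltnW mn); have := bY m (ltnW mn).
  move=> bYm bXm bSm.
  apply: wp_if; [exact: safe_degE em mn | by [] | |];
    rewrite (eval_degE em mn) [eval _ _ _]/= ei2 => cmp.
    apply: wp_asg.
      split; [by [] | exact: safe_degE em mn | rewrite (eval_degE em mn) /=]; lia.
    have -> : eval inp s2 (Add (Var r_out) degE) = reg s2 r_out + deg m.
      by rewrite -(eval_degE em mn).
    rewrite /= /update /=; split;
      by rewrite ?big_ord_recr /= ?eS ?eX ?eY leqNgt cmp /= ?addn0.
  apply: wp_seq; apply: wp_asg.
    split; [by [] | exact: safe_degE em mn | rewrite (eval_degE em mn) /=]; lia.
  have -> : eval inp s2 (Add (Var r_in) degE) = reg s2 r_in + deg m.
    by rewrite -(eval_degE em mn).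
  apply: wp_asg; first by rewrite /= /update /=; split=> //; lia.
  by rewrite /= /update /=; split; rewrite big_ord_recr /= ?eS ?eX ?eY cmp /= ?addn0.
move=> s2 f2 [eS eX eY].
have hS : thr_size n nb i <= n by have := bS n (leqnn n); rewrite muln1.
have hX : thr_in n nb i <= n * n := bX n (leqnn n).
have hY : thr_out n nb i <= n * n := bY n (leqnn n).
have hSS : thr_size n nb i * thr_size n nb i <= n * n by apply: leq_mul.
have ei2 : reg s2 r_D = i by frw f2; rewrite /= /update /=.
have eF2 : reg s2 r_found = reg s' r_found by frw f2; rewrite /= /update /=.
have eT2 : reg s2 r_thr = reg s' r_thr by frw f2; rewrite /= /update /=.
have ek2 : reg s2 r_K = K by frw f2; rewrite /= /update /=.
have no : ~~ thr_ok n k nb i ->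
  (reg (setr s2 r_D i.+1) r_found = 1 /\ thr_ok n k nb (reg (setr s2 r_D i.+1) r_thr)) \/
  (reg (setr s2 r_D i.+1) r_found = 0 /\ (forall D, D < i.+1 -> ~~ thr_ok n k nb D)).
  rewrite /= /update /= eF2 eT2 => nok; case: J => [|[eF hD]]; first by left.
  right; split=> // D; rewrite ltnS leq_eqVlt => /orP[/eqP -> //|]; exact: hD.
apply: wp_ifeq => /=; rewrite ?eS ?eX ?eY.
- by do ?split=> //; lia.
- by do ?split=> //; lia.
- move=> e1; apply: wp_if => //=; rewrite ?eS ?ek2.
  + by do ?split=> //; lia.
  + move=> lt; apply: wp_seq; apply: wp_asg => //; apply: wp_asg; first by rewrite /=; lia.
    left; rewrite /= /update /= ei2; split=> //.
    by rewrite /thr_ok e1 eqxx; lia.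
  + by move=> le; apply: wp_skip; apply: no; rewrite /thr_ok negb_and; lia.
- by move=> ne; apply: wp_skip; apply: no; rewrite /thr_ok negb_and ne.
Qed.

(** When no threshold passes, the degree test alone decides: in a split graph the clique is then too
    large to receive two labels within the budget. *)
Lemma main_cmdP s :
  (forall x, reg s x = 0) -> (forall t i, arr s t i = 0) ->
  (forall D, thr_ok n k nb D -> forall v, v < n -> deg v < D ->
      deg v <= K /\ {in nb v, forall y, D <= deg y}) ->
  wp main_cmd s (fun s' => exists r : bool, [/\ reg s' r_res = r,
    r -> excess n k h (fun=> 0) deg <= k \/
      exists2 D, thr_ok n k nb D & exists x, leaf n k h nb D (digit k x) <= k &
    ~~ r -> k < excess n k h (fun=> 0) deg /\
      ((forall D, D < k.+3 -> ~~ thr_ok n k nb D) \/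
       exists2 D, thr_ok n k nb D &
         forall x, x < K ^ k -> k < leaf n k h nb D (digit k x))]).
Proof.
move=> s0 a0 hout.
apply: wp_seq; apply: wp_asg; first by rewrite /=; split; lia.
apply: wp_seq; apply: wp_asg; first by rewrite /= inp_k; do ?split; lia.
apply: wp_seq; apply: wp_asg; first by rewrite /=; split; lia.
rewrite /= inp_n inp_k inp_h addn1.
set s1 := setr _ r_h _.
have cs1 : consts s1 by [].
apply: wp_seq.
apply: (@wp_mono _ _ _ _ _ _ (fun s2 => forall v, v < n -> arr s2 a_wt v = deg v)).
  apply: (@wp_for _ _ _ _ _ _ _ _ _ n (fun m s2 =>
    forall v, v < m -> arr s2 a_wt v = deg v)) => //.
  - by lia.
  - by lia.
  - by move=> s2 f2 /=; frw f2.
  move=> m s2 mn f2 em J.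
  apply: wp_sto; [by [] | exact: safe_degE em mn | by rewrite /= em; lia |].
  rewrite (eval_degE em mn) /= em => v.
  rewrite ltnS leq_eqVlt /update => /orP[/eqP ->|vm]; first by rewrite eqxx.
  by rewrite (ltn_eqF vm) J.
move=> s2 f2 hw.
have cs2 : consts s2 by apply: consts_frame f2 _ cs1.
have z2 x : x \notin [:: 0; 1; 2; 5] -> reg s2 x = 0.
  rewrite !inE !negb_or => /and4P[? ? ? n5]; rewrite (proj1 f2) ?inE ?negb_or ?n5 //.
  by rewrite /= /update !ifN.
have zl2 t : t != a_wt -> arr s2 t =1 (fun=> 0).
  by move=> nt i; rewrite (proj2 f2) ?inE //= a0.
apply: wp_seq.
apply: wp_mono (@excess_cmdP _ (fun=> 0) deg 0 cs2 _ _ _ hw) _.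
- by rewrite z2.
- by lia.
- by move=> v vn; rewrite zl2.
rewrite add0n => s3 f3 ec3.
have cs3 : consts s3 by apply: consts_frame f3 _ cs2.
apply: wp_seq.
apply: (@wp_mono _ _ _ _ _ _ (fun s4 => reg s4 r_res = (excess n k h (fun=> 0) deg <= k))).
  have [_ ek _] := cs3.
  have er : reg s3 r_res = 0 by frw f3; rewrite z2.
  apply: wp_if => //=; rewrite ec3 ek => cmp.
    by apply: wp_asg => /=; [lia | rewrite /update /= -ltnS cmp].
  by apply: wp_skip; rewrite er leqNgt cmp.
move=> s4 f4 er4.
have cs4 : consts s4 by apply: consts_frame f4 _ cs3.
apply: wp_seq; apply: wp_mono (threshold_cmdP cs4 _) _.
  by frw f4; frw f3; rewrite z2.
move=> s5 f5 hf.
have cs5 : consts s5 by apply: consts_frame f5 _ cs4.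
have er5 : reg s5 r_res = (excess n k h (fun=> 0) deg <= k) by frw f5.
apply: wp_if => //=; first lia.
  case: hf => [[_ ok] _|[-> _] //].
  have sK : thr_size n nb (reg s5 r_thr) <= K by case/andP: ok.
  apply: wp_mono (search_cmdP cs5 erefl _ _ er5 sK (hout _ ok)) _.
  - by move=> i; frw f5; frw f4; frw f3; rewrite zl2 //; case: i => // i; rewrite /digit div0n mod0n.
  - by frw f5; frw f4; frw f3; rewrite z2.
  move=> s6 f6 er6; eexists; split; first exact: er6.
    case/orP => [|/hasP[x _ hx]]; first by left.
    by right; exists (reg s5 r_thr) => //; exists x.
  rewrite negb_or -ltnNge => /andP[h1 /hasPn h2]; split=> //; right.
  exists (reg s5 r_thr) => // x xK.
  by rewrite ltnNge; apply: h2; rewrite mem_iota.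
case: hf => [[-> _] //|[_ hno] _]; apply: wp_skip; eexists; split; first exact: er5.
  by left.
by rewrite -ltnNge; split=> //; left.
Qed.

End Verify.

(** * Least-weight removal *)

Lemma count_iota (p : pred nat) m : count p (iota 0 m) = \sum_(u < m) (p u : nat).
Proof.
elim: m => [|m IH]; first by rewrite big_ord0.
by rewrite -addn1 iotaD count_cat addn1 big_ord_recr /= IH addn0.
Qed.

Lemma nth_filter_iota (p : pred nat) m v :
  v < m -> p v -> nth 0 [seq u <- iota 0 m | p u] (\sum_(u < v) (p u : nat)) = v.
Proof.
move=> vm pv; rewrite -(subnKC vm) addSnnS iotaD filter_cat nth_cat.
by rewrite size_filter count_iota ltnn subnn /= pv.
Qed.

(** Turns a list of guessed labels into the number of the guess, which the search will reach. *)
Lemma digits_exist k m (b : nat -> nat) :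
  (forall i, b i <= k) ->
  exists2 x, x < k.+1 ^ m &
    forall i, (x %/ k.+1 ^ i) %% k.+1 = if i < m then b i else 0.
Proof.
elim: m b => [|m IH] b hb.
  by exists 0 => // i; rewrite div0n mod0n.
have [x xm hx] := IH (b \o succn) (fun i => hb i.+1).
have h0 := hb 0; exists (x * k.+1 + b 0).
  rewrite expnS mulnC; apply: leq_trans (_ : k.+1 * x.+1 <= _).
    by rewrite mulnS; lia.
  by rewrite leq_mul2l xm orbT.
case=> [|i].
  by rewrite expn0 divn1 modnMDl modn_small.
by rewrite expnS divnMA divnMDl // (@divn_small (b 0)) ?addn0 ?hx.
Qed.

Lemma card_rel n (P : rel 'I_n) :
  #|[set p : 'I_n * 'I_n | P p.1 p.2]| = \sum_x #|P x|.
Proof.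
rewrite -sum1_card (eq_bigl (fun p => P p.1 p.2)); last by move=> p; rewrite inE.
rewrite -(pair_big_dep xpredT P (fun _ _ => 1)).
by apply: eq_bigr => x _; rewrite sum1_card; apply: eq_card.
Qed.

Lemma sum_level b m : \sum_(t < m) (t < b : nat) = minn b m.
Proof.
elim: m => [|m IH]; first by rewrite big_ord0 minn0.
by rewrite big_ord_recr /= IH; case: ltnP; lia.
Qed.

(** Vertices of least weight are peeled off until at most [h] are left. The kept set [R] is then
    heaviest, so every level set loses exactly its surplus over [h]; summing over the levels gives
    the truncated weights. *)
Lemma excess_peel n h K (S : {set 'I_n}) (wt : nat -> nat) :
  exists2 R : {set 'I_n}, R \subset S /\ #|R| <= h &
    \sum_(v in S :\: R) minn (wt v) K =
    \sum_(t < K) (#|[set v in S | t < wt v]| - h).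
Proof.
have [m] := ubnP #|S|; elim: m S => // m IH S; rewrite ltnS => hS.
have [le|gt] := leqP #|S| h.
  exists S; rewrite ?setDv // big_set0 big1 // => t _; apply/eqP.
  rewrite subn_eq0; apply: leq_trans le; apply: subset_leq_card.
  by apply/subsetP => v; rewrite inE => /andP[].
have /card_gt0P[v0 v0S] : 0 < #|S| by apply: leq_ltn_trans gt.
case: (arg_minnP (fun v : 'I_n => wt v) v0S) => v vS0 vmin; have vS : v \in S := vS0.
have cS : #|S| = #|S :\ v|.+1 by rewrite (cardsD1 v) vS.
have [|R [/subsetD1P[RS vR] hR] eR] := IH (S :\ v); first by rewrite -cS.
(* Removing [v], of least weight, costs one more in each level below its weight. *)
exists R => //; rewrite (big_setD1 v) /=; last by rewrite inE vR.
have -> : (S :\: R) :\ v = (S :\ v) :\: R.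
  by apply/setP => x; rewrite !inE andbCA.
rewrite eR -sum_level -big_split /=; apply: eq_bigr => t _.
have -> : #|[set x in S | t < wt x]| = (t < wt v) + #|[set x in S :\ v | t < wt x]|.
  rewrite (cardsD1 v) inE vS /=; congr (_ + _); apply: eq_card => x.
  by rewrite !inE andbA.
case: ltnP => // lt; rewrite addnBA //.
suff -> : #|[set x in S :\ v | t < wt x]| = #|S :\ v| by rewrite -ltnS -cS.
apply: eq_card => x; rewrite !inE; case: (boolP (x \in S)) => xS; rewrite ?andbF //.
by rewrite (leq_trans lt (vmin x xS)) !andbT.
Qed.

Lemma levelE n (lab wt : nat -> nat) j t :
  level n lab wt j t = #|[set v : 'I_n | (lab v == j) && (t < wt v)]|.
Proof.
rewrite /level -sum1_card big_mkcond [RHS]big_mkcond /=.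
by apply: eq_bigr => v _; rewrite inE; case: (_ && _).
Qed.

(** The upper bound: classes do not interact, so each is peeled on its own. *)
Lemma excess_kept n k h (lab wt : nat -> nat) :
  (forall v, v < n -> lab v <= k) ->
  exists2 R : {set 'I_n},
    forall j, j <= k -> #|[set v in R | lab v == j]| <= h &
    \sum_(v in ~: R) minn (wt v) k.+1 = excess n k h lab wt.
Proof.
move=> hl; pose S (j : 'I_k.+1) := [set v : 'I_n | lab v == j].
have /fin_all_exists2[f hf ef] := fun j => excess_peel h k.+1 (S j) wt.
pose c (v : 'I_n) : 'I_k.+1 := inord (lab v).
have cE v : c v = lab v :> nat by rewrite inordK // ltnS hl.
have inS v j : (v \in S j) = (c v == j) by rewrite inE -cE.
exists [set v | v \in f (c v)].
  move=> j jk; have [sub le] := hf (Ordinal (jk : j < k.+1)).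
  apply: leq_trans le; apply: subset_leq_card; apply/subsetP => v.
  rewrite !inE => /andP[vf /eqP lj].
  by rewrite (_ : Ordinal _ = c v) //; apply: val_inj; rewrite /= cE lj.
rewrite (partition_big c xpredT) //=; apply: eq_bigr => j _.
rewrite (_ : \sum_(t < k.+1) _ = \sum_(t < k.+1) (#|[set v in S j | t < wt v]| - h)); last first.
  apply: eq_bigr => t _; rewrite levelE; congr (_ - _); apply: eq_card => v.
  by rewrite !inE.
rewrite -ef; apply: eq_bigl => v; rewrite in_setD in_setC inS inE.
by case: (eqVneq (c v) j) => [->|]; rewrite ?andbT ?andbF.
Qed.

(** The lower bound: outside [Z], the vertices of positive weight in class [j] share the value
    [cls j] of [g], so any level contains at most [h] of them and its surplus is covered by [Z].
    Truncation at [k + 1] only decreases the left-hand side. *)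
Lemma excess_le n k h (lab wt : nat -> nat) (Z : {set 'I_n}) (g cls : nat -> nat) :
  (forall c, #|[set v : 'I_n | g v == c]| <= h) ->
  (forall v : 'I_n, v \notin Z -> 0 < wt v -> g v = cls (lab v)) ->
  excess n k h lab wt <= \sum_(v in Z) wt v.
Proof.
move=> hg hc.
have step j t : level n lab wt j t - h <=
    \sum_(v in Z) ((lab v == j) && (t < wt v)).
  rewrite leq_subLR levelE.
  apply: leq_trans (_ : #|[set v : 'I_n | g v == cls j] :|:
     [set v in Z | (lab v == j) && (t < wt v)]| <= _).
    apply: subset_leq_card; apply/subsetP => v; rewrite !inE => /andP[/eqP lj tv].
    case: (boolP (v \in Z)) => vZ; rewrite lj eqxx tv ?orbT //=.
    by rewrite hc ?lj ?eqxx //; apply: leq_ltn_trans tv.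
  rewrite cardsU; apply: leq_trans (leq_subr _ _) _; apply: leq_add => //.
  rewrite -sum1_card big_mkcond [leqRHS]big_mkcond /=.
  by apply: leq_sum => v _; rewrite inE; case: (v \in Z) => //=; case: (_ && _).
apply: leq_trans (_ : \sum_(j < k.+1) \sum_(t < k.+1)
    \sum_(v in Z) ((lab v == j) && (t < wt v)) <= _).
  by apply: leq_sum => j _; apply: leq_sum => t _.
rewrite (eq_bigr (fun j : 'I_k.+1 => \sum_(v in Z) \sum_(t < k.+1)
   ((lab v == j) && (t < wt v)))); last by move=> j _; rewrite exchange_big.
rewrite exchange_big /=; apply: leq_sum => v _.
have inner (j : 'I_k.+1) : \sum_(t < k.+1) ((lab v == j) && (t < wt v)) <=
    if lab v == j then wt v else 0.
  case: eqP => _; last by rewrite big1.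
  by rewrite sum_level geq_minl.
apply: leq_trans (leq_sum _ (fun j _ => inner j)) _.
rewrite -big_mkcond /=; case: (ltnP (lab v) k.+1) => lk; last first.
  by rewrite big_pred0 // => j; rewrite gtn_eqF //; apply: leq_trans lk.
by rewrite (big_pred1 (Ordinal lk)) // => j; rewrite eq_sym.
Qed.

(** * Split graphs *)

Section Labellings.

Variables (n : nat) (G : sgraph n).
Implicit Types (g : 'I_n -> nat) (P : rel 'I_n).
Local Notation E := (edge G).

Definition ecut g :=
  #|[set e in edge_set G | [exists x in e, exists y in e, g x != g y]]|.

Lemma edge_setP x y : E x y -> [set x; y] \in edge_set G.
Proof.
by move=> xy; rewrite inE; apply/existsP; exists x; apply/existsP; exists y; rewrite xy eqxx.
Qed.

Lemma set2_eq (x y z t : 'I_n) :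
  [set x; y] = [set z; t] -> (x = z /\ y = t) \/ (x = t /\ y = z).
Proof.
move=> e; have : x \in [set z; t] by rewrite -e set21.
have : y \in [set z; t] by rewrite -e set22.
have : z \in [set x; y] by rewrite e set21.
have : t \in [set x; y] by rewrite e set22.
rewrite !inE => /pred2P[] -> /pred2P[] -> /pred2P[] H1 /pred2P[] H2; subst; auto.
Qed.

Lemma del_edges_sym F : symmetric (del_edges G F).
Proof. by move=> x y; rewrite /del_edges /= (edge_sym G) setUC. Qed.

Lemma bichromaticP g x y : E x y -> g x != g y ->
  [set x; y] \in [set e in edge_set G | [exists x in e, exists y in e, g x != g y]].
Proof.
move=> xy gxy; rewrite inE edge_setP //=.
by apply/existsP; exists x; rewrite set21; apply/existsP; exists y; rewrite set22.
Qed.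

(** Delete the edges with two different labels: the remaining paths are monochromatic. *)
Lemma ecut_tfed k h g :
  (forall c, #|[set x | g x == c]| <= h) -> ecut g <= k ->
  tree_free_edge_deletion G k h.
Proof.
move=> hg hk; apply/existsP.
exists [set e in edge_set G | [exists x in e, exists y in e, g x != g y]].
apply/and3P; split=> //; first by apply/subsetP => e; rewrite inE => /andP[].
set F := finset _; have cg x y : connect (del_edges G F) x y -> g x = g y.
  case/connectP => p + ->; elim: p x => //= z p IH x /andP[/andP[xz nF] /IH <-].
  by apply/eqP; apply: contraNT nF => ne; apply: bichromaticP.
apply/forallP => A; apply/implyP => /imsetP[x _ ->].
apply: leq_trans (hg (g x)); apply: subset_leq_card; apply/subsetP => y.
by rewrite !inE /= => /cg ->.
Qed.

(** Label each vertex by the root of its component; only deleted edges can join different roots. *)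
Lemma tfed_ecut k h :
  tree_free_edge_deletion G k h ->
  exists2 g, forall c, #|[set x | g x == c]| <= h & ecut g <= k.
Proof.
move=> /existsP[F /and3P[FE Fk /forallP hA]].
have cs := sym_connect_sym (del_edges_sym F).
pose g x : nat := root (del_edges G F) x.
have gE x y : (g x == g y) = connect (del_edges G F) x y.
  by rewrite val_eqE root_connect.
exists g => [c|].
  have [->|/set0Pn[x0]] := eqVneq [set x | g x == c] set0; first by rewrite cards0.
  rewrite inE => /eqP <-.
  have /implyP := hA [set y in [set: 'I_n] | connect (del_edges G F) x0 y].
  have -> : [set x | g x == g x0] = [set y in [set: 'I_n] | connect (del_edges G F) x0 y].
    by apply/setP => y; rewrite !inE eq_sym gE.
  by apply; apply/imsetP; exists x0; rewrite ?inE.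
apply: leq_trans Fk; apply: subset_leq_card; apply/subsetP => e.
rewrite inE => /andP[]; rewrite inE => /existsP[a /existsP[b /andP[ab /eqP ->]]].
move=> /existsP[x /andP[xe /existsP[y /andP[ye]]]]; apply: contraNT => nF.
have hab : g a = g b by apply/eqP; rewrite gE; apply: connect1; rewrite /del_edges /= ab nF.
by move: xe ye; rewrite !inE => /pred2P[] -> /pred2P[] ->; rewrite ?hab.
Qed.

(** [P] charges an edge to an end. Here every cut edge must be charged at least once; for the
    reverse bound [le_ecut], only cut edges may be charged, and never from both ends. *)
Lemma ecut_le P g :
  (forall x y, E x y -> g x != g y -> P x y \/ P y x) ->
  ecut g <= \sum_x #|P x|.
Proof.
move=> h; rewrite -card_rel.
apply: leq_trans (leq_imset_card (fun p => [set p.1; p.2]) _).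
apply: subset_leq_card; apply/subsetP => e.
rewrite inE => /andP[]; rewrite inE => /existsP[a /existsP[b /andP[ab /eqP ->]]].
move=> /existsP[x /andP[xe /existsP[y /andP[ye gxy]]]].
have gab : g a != g b.
  apply: contraNneq gxy => e'.
  by move: xe ye; rewrite !inE => /pred2P[] -> /pred2P[] ->; rewrite ?e'.
by case: (h a b ab gab) => p; apply/imsetP;
  [exists (a, b); rewrite ?inE | exists (b, a); rewrite ?inE // setUC].
Qed.

Lemma le_ecut P g :
  (forall x y, P x y -> [/\ E x y, g x != g y & ~~ P y x]) ->
  \sum_x #|P x| <= ecut g.
Proof.
move=> h; rewrite -card_rel.
rewrite -(card_in_imset (f := fun p : 'I_n * 'I_n => [set p.1; p.2])).
  apply: subset_leq_card; apply/subsetP => e /imsetP[[x y] /=].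
  by rewrite inE => /h[xy gxy _] ->; apply: bichromaticP.
move=> [x y] [z t] /=; rewrite !inE /= => pxy pzt /set2_eq[[-> ->] //|[ex ey]].
by have [_ _] := h _ _ pxy; rewrite ex ey pzt.
Qed.

(** A removed vertex [x] gets the fresh label [K + x] and forms a class of its own, admissible since
    [0 < h]. *)
Lemma kept_classes (R : {set 'I_n}) (l : 'I_n -> nat) K h :
  0 < h -> (forall x, l x < K) ->
  (forall j, j < K -> #|[set x in R | l x == j]| <= h) ->
  forall c, #|[set x | (if x \in R then l x else K + x) == c]| <= h.
Proof.
move=> h0 lK hR c; have [cK|Kc] := ltnP c K.
  apply: leq_trans (hR c cK); apply: subset_leq_card; apply/subsetP => x.
  by rewrite !inE; case: ifP => // _; lia.
have [->|/set0Pn[x0]] := eqVneq [set x | (if x \in R then l x else K + x) == c] set0.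
  by rewrite cards0.
rewrite inE => h1; apply: leq_trans h0; rewrite -(cards1 x0).
apply: subset_leq_card; apply/subsetP => x; rewrite !inE -val_eqE /=.
move: h1; have := lK x; have := lK x0; case: ifP => _; case: ifP => _; lia.
Qed.

End Labellings.

(** * Recognising the clique by a degree threshold *)

Section Thresholds.

Variables (n : nat) (G : sgraph n).
Local Notation E := (edge G).

Definition gdeg x := #|E x|.

Definition upper D := [set x | D <= gdeg x].

Lemma gdegE x (A : {set 'I_n}) :
  gdeg x = #|[set y in A | E x y]| + #|[set y in ~: A | E x y]|.
Proof.
rewrite /gdeg -(cardID (mem A) (E x)); congr (_ + _); apply: eq_card => y;
  by rewrite !inE andbC.
Qed.

Lemma sum_adj_swap (A B : {set 'I_n}) :
  \sum_(x in A) #|[set y in B | E x y]| = \sum_(y in B) #|[set x in A | E y x]|.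
Proof.
have e (C : {set 'I_n}) x : #|[set y in C | E x y]| = \sum_(y in C) (E x y : nat).
  rewrite -sum1_card big_mkcond [RHS]big_mkcond /=; apply: eq_bigr => y _.
  by rewrite inE; case: (y \in C) => //=; case: (E x y).
rewrite (eq_bigr _ (fun x _ => e B x)) (eq_bigr _ (fun x _ => e A x)) exchange_big /=.
by apply: eq_bigr => y _; apply: eq_bigr => x _; rewrite (edge_sym G).
Qed.

(** Edges leaving [A] contribute equally to both degree sums and cancel. The ordered adjacent pairs
    inside [A], at most [#|A| * #|A| - #|A|] in number, must then equal that bound plus the ordered
    adjacent pairs outside [A]; so the former attain the bound and the latter are absent. *)
Lemma split_degree_sum (A : {set 'I_n}) :
  \sum_(x in A) gdeg x + #|A| = \sum_(x in ~: A) gdeg x + #|A| * #|A| <->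
  clique G A /\ independent G (~: A).
Proof.
rewrite (eq_bigr _ (fun x _ => gdegE x A)) [in RHS](eq_bigr _ (fun x _ => gdegE x A)).
rewrite !big_split /= (sum_adj_swap (~: A) A) addnC addnA.
set X := \sum_(x in A) #|[set y in A | _]|.
set Y := \sum_(x in A) #|[set y in ~: A | _]|.
set Z := \sum_(x in ~: A) #|[set y in ~: A | _]|.
have hx x : x \in A -> #|[set y in A | E x y]| + 1 <= #|A|.
  move=> xA; rewrite (cardsD1 x A) xA addnC leq_add2l; apply: subset_leq_card.
  apply/subsetP => y; rewrite !inE => /andP[-> xy]; rewrite andbT.
  by apply: contraTneq xy => ->; rewrite (edge_irr G).
have sX : X + #|A| = \sum_(x in A) (#|[set y in A | E x y]| + 1).
  by rewrite big_split /= sum1_card.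
have leX : X + #|A| <= #|A| * #|A|.
  by rewrite sX -sum_nat_const; apply: leq_sum => x /hx.
split=> [e|[cA iA]].
  have aux a x y z s : a + x + y = y + z + s -> x + a <= s -> z = 0 /\ x + a = s by lia.
  have [Z0 X0] := aux _ _ _ _ _ e leX.
  split=> [x y xA yA ne|x y xA yA].
    have : #|[set y in A | E x y]| + 1 = #|A|.
      apply/eqP; rewrite eqn_leq hx //= leqNgt; apply/negP => lt.
      have : X + #|A| < #|A| * #|A|.
        rewrite sX -sum_nat_const (bigD1 x) //= [ltnRHS](bigD1 x) //= -addSn.
        by apply: leq_add => //; apply: leq_sum => z /andP[/hx].
      by rewrite X0 ltnn.
    rewrite (cardsD1 x A) xA addnC => /eqP; rewrite eqn_add2l => /eqP ec.
    have sub : [set y in A | E x y] \subset A :\ x.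
      apply/subsetP => z; rewrite !inE => /andP[-> xz]; rewrite andbT.
      by apply: contraTneq xz => ->; rewrite (edge_irr G).
    have /eqP es : [set y in A | E x y] == A :\ x by rewrite eqEcard sub ec leqnn.
    by have : y \in A :\ x by [rewrite !inE yA eq_sym ne]; rewrite -es inE yA.
  move/eqP: Z0; rewrite sum_nat_eq0 => /forallP/(_ x)/implyP/(_ xA).
  by rewrite cards_eq0 => /eqP/setP/(_ y); rewrite in_set0 inE yA /= => ->.
have -> : Z = 0.
  apply: big1 => x xA; apply/eqP; rewrite cards_eq0; apply/eqP/setP => y.
  by rewrite in_set0 inE; apply/negP => /andP[yA]; apply/negP; apply: iA.
have -> : #|A| * #|A| = X + #|A|.
  rewrite sX -sum_nat_const; apply: eq_bigr => x xA.
  rewrite (cardsD1 x A) xA addnC; congr (_ + _); apply: eq_card => y.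
  rewrite !inE andbC; case: (boolP (y \in A)) => yA; rewrite ?andbF ?andbT //.
  apply/idP/idP => [ne|]; first by apply: cA; rewrite // eq_sym.
  by apply: contraTneq => ->; rewrite (edge_irr G).
by rewrite addn0 addnC [#|A| + X]addnC.
Qed.

Lemma split_threshold :
  split_graph G -> exists D, clique G (upper D) /\ independent G (~: upper D).
Proof.
move=> [C0 [cC0 iC0]].
pose ok (C : {set 'I_n}) := [forall x in C, forall y in C, (x != y) ==> E x y] &&
             [forall x in ~: C, forall y in ~: C, ~~ E x y].
have okP C : reflect (clique G C /\ independent G (~: C)) (ok C).
  apply: (iffP andP) => [[/forall_inP h1 /forall_inP h2]|[h1 h2]]; split.
  - by move=> x y xC yC ne; move/forall_inP: (h1 x xC) => /(_ y yC)/implyP; apply.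
  - by move=> x y xC yC; move/forall_inP: (h2 x xC) => /(_ y yC).
  - apply/forall_inP => x xC; apply/forall_inP => y yC; apply/implyP; exact: h1.
  - apply/forall_inP => x xC; apply/forall_inP => y yC; exact: h2.
have ok0 : ok C0 by apply/okP.
(* For a largest clique C, vertices outside C have degree < #|C|.  If one of them
   has degree #|C| - 1, then at most one vertex of C has degree < #|C|. *)
case: (arg_maxnP (fun C : {set 'I_n} => #|C|) ok0) => C /okP[cC iC] maxC.
have nbI v : v \notin C -> [set y in ~: C | E v y] = set0.
  move=> vC; apply/setP => y; rewrite in_set0 inE; apply/negP => /andP[yC].
  by apply/negP; apply: iC => //; rewrite inE.
have dI v : v \notin C -> gdeg v = #|[set y in C | E v y]|.
  by move=> vC; rewrite (gdegE v C) nbI // cards0 addn0.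
have nbC u : u \in C -> [set y in C | E u y] = C :\ u.
  move=> uC; apply/setP => y; rewrite !inE andbC.
  case: (boolP (y \in C)) => yC; rewrite ?andbF ?andbT //.
  apply/idP/idP => [|ne]; last by apply: cC; rewrite // eq_sym.
  by apply: contraTneq => ->; rewrite (edge_irr G).
have dC u : u \in C -> (gdeg u).+1 = #|C| + #|[set y in ~: C | E u y]|.
  by move=> uC; rewrite (gdegE u C) nbC // (cardsD1 u C) uC.
have ltI v : v \notin C -> gdeg v < #|C|.
  move=> vC; rewrite ltnNge; apply/negP; rewrite dI // => le.
  have /eqP es : [set y in C | E v y] == C.
    by rewrite eqEcard le andbT; apply/subsetP => y; rewrite inE => /andP[].
  have vE y : y \in C -> E v y by rewrite -{1}es inE => /andP[].
  have okv : ok (v |: C).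
    apply/okP; split=> x y; rewrite !inE.
      move=> /predU1P[->|xC] /predU1P[->|yC]; rewrite ?eqxx //.
      - by move=> _; apply: vE.
      - by move=> _; rewrite (edge_sym G); apply: vE.
      - exact: cC.
    by rewrite !negb_or => /andP[_ xC] /andP[_ yC]; apply: iC; rewrite inE.
  have : #|v |: C| <= #|C| := maxC _ okv.
  by rewrite cardsU1 vC add1n ltnn.
have [/existsP[v /andP[vC /eqP dv]]|/existsPn noI] :=
    boolP [exists v, (v \notin C) && ((gdeg v).+1 == #|C|)].
  exists #|C|.
  have sub : upper #|C| \subset C.
    apply/subsetP => x; rewrite inE => le; apply: contraLR le => xC.
    by rewrite -ltnNge ltI.
  split=> [x y xU yU ne|x y]; first by apply: cC => //; apply: (subsetP sub).
  rewrite !inE -!ltnNge => dx dy.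
  have noI z t : gdeg z < #|C| -> z \in C -> t \notin C -> ~~ E z t.
    move=> dz zC tC; have := dC z zC.
    have le1 : #|[set y in ~: C | E z y]| <= 0 -> ~~ E z t.
      rewrite leqn0 cards_eq0 => /eqP/setP/(_ t).
      by rewrite in_set0 inE in_setC tC /= => ->.
    by move=> e; apply: le1; lia.
  (* A vertex of [C] of degree below [#|C|] has no neighbour outside [C], so [v] misses it; two such
     vertices would leave [v] with degree at most [#|C| - 2]. *)
  have uniqC z t : gdeg z < #|C| -> gdeg t < #|C| -> z \in C -> t \in C -> z = t.
    move=> dz dt zC tC; apply/eqP; apply/negPn; apply/negP => ne.
    have nz : ~~ E v z by rewrite (edge_sym G); apply: noI.
    have nt : ~~ E v t by rewrite (edge_sym G); apply: noI.
    have : #|[set y in C | E v y]| <= #|(C :\ z) :\ t|.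
      apply: subset_leq_card; apply/subsetP => u; rewrite !inE => /andP[-> vu].
      by rewrite andbT; apply/andP; split; apply: contraTneq vu => ->.
    rewrite -dI //; move: dv; rewrite (cardsD1 z C) zC (cardsD1 t (C :\ z)).
    have -> : t \in C :\ z by rewrite !inE tC eq_sym ne.
    by rewrite !add1n => -[->]; rewrite ltnn.
  case: (boolP (x \in C)) => xC; case: (boolP (y \in C)) => yC.
  - by rewrite (uniqC x y) // (edge_irr G).
  - exact: noI.
  - by rewrite (edge_sym G); apply: noI.
  - by apply: iC; rewrite inE.
(* Now every vertex outside [C] falls below this threshold, while those of [C] reach it inside [C]
   already. *)
exists #|C|.-1.
suff -> : upper #|C|.-1 = C by [].
apply/setP => x; rewrite inE; case: (boolP (x \in C)) => xC.
  by have := dC x xC; lia.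
apply/negbTE; rewrite -ltnNge.
have ne : (gdeg x).+1 != #|C| by have := noI x; rewrite xC.
by have := ltI x xC; move: ne; set d := gdeg x; set c := #|C|; lia.
Qed.

End Thresholds.

(** * Soundness and completeness of the degree test and of the guesses *)

Section Instance.

Variables (n : nat) (G : sgraph n) (adj : 'I_n -> seq 'I_n).
Hypothesis adjP : adjacency_lists G adj.
Local Notation E := (edge G).

Definition nbr (v : nat) : seq nat :=
  oapp (fun x => [seq val y | y <- adj x]) [::] (insub v : option 'I_n).

Local Notation deg := (deg nbr).

Lemma nbr_val (x : 'I_n) : nbr x = [seq val y | y <- adj x].
Proof. by rewrite /nbr valK. Qed.

Lemma mem_nbr (x y : 'I_n) : (val y \in nbr x) = E x y.
Proof. by rewrite nbr_val mem_map; [have [_ ->] := adjP x | apply: val_inj]. Qed.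

Lemma nbrP (x : 'I_n) v : v \in nbr x -> exists2 y : 'I_n, E x y & v = y.
Proof.
rewrite nbr_val => /mapP[y yx ->]; exists y => //.
by have [_ /(_ y)] := adjP x; rewrite yx => /esym.
Qed.

Lemma count_nbr (p : pred nat) (x : 'I_n) :
  count p (nbr x) = #|[pred y : 'I_n | E x y && p y]|.
Proof.
have [u m] := adjP x; have mE y : (y \in adj x) = E x y := m y.
rewrite nbr_val count_map -size_filter -(card_uniqP (filter_uniq _ u)).
by apply: eq_card => y; rewrite mem_filter !inE mE andbC.
Qed.

Lemma deg_nbr (x : 'I_n) : deg x = gdeg G x.
Proof.
have -> : deg x = count predT (nbr x) by rewrite count_predT.
rewrite count_nbr; apply: eq_card => y.
by rewrite !inE andbT.
Qed.

Lemma deg_le_n (x : 'I_n) : deg x <= n.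
Proof. by rewrite deg_nbr; apply: leq_trans (max_card _) _; rewrite card_ord. Qed.

Lemma thr_okP k D :
  thr_ok n k nbr D <->
  [/\ clique G (upper G D), independent G (~: upper G D) & #|upper G D| <= k.+1].
Proof.
have inU (x : 'I_n) : (x \in upper G D) = (D <= deg x) by rewrite inE deg_nbr.
have -> : thr_ok n k nbr D =
  (\sum_(x in upper G D) gdeg G x + #|upper G D| ==
   \sum_(x in ~: upper G D) gdeg G x + #|upper G D| * #|upper G D|) &&
  (#|upper G D| <= k.+1).
  rewrite /thr_ok; have -> : thr_size n nbr D = #|upper G D|.
    rewrite -sum1_card big_mkcond /=; apply: eq_bigr => x _; rewrite inU.
    by case: ifP.
  have -> : thr_in n nbr D = \sum_(x in upper G D) gdeg G x.
    by rewrite [RHS]big_mkcond /=; apply: eq_bigr => x _; rewrite inU deg_nbr.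
  have -> // : thr_out n nbr D = \sum_(x in ~: upper G D) gdeg G x.
  rewrite [RHS]big_mkcond /=; apply: eq_bigr => x _; rewrite in_setC inU deg_nbr.
  by case: ifP.
split=> [/andP[/eqP /split_degree_sum[? ?] ?]|[? ? ->]]; first by split.
by rewrite andbT; apply/eqP/split_degree_sum; split.
Qed.

Variables (k h : nat).
Hypothesis h_gt0 : 0 < h.
Local Notation K := k.+1.

(** [R] keeps one common label and every other vertex is isolated. An edge between two isolated
    vertices is charged twice, which an upper bound tolerates. *)
Lemma degrees_sound :
  excess n k h (fun=> 0) deg <= k -> tree_free_edge_deletion G k h.
Proof.
move=> le; have [R hR eR] := @excess_kept n k h (fun=> 0) deg (fun _ _ => leq0n k).
pose g (x : 'I_n) := if x \in R then 0 else K + x.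
apply: (@ecut_tfed _ _ _ _ g).
  apply: (@kept_classes n R (fun=> 0) K h) => // j jK; exact: hR.
apply: leq_trans (_ : \sum_x #|[pred y | (x \notin R) && E x y]| <= k).
  apply: (@ecut_le _ _ (fun x y => (x \notin R) && E x y)) => x y xy.
  rewrite /g xy (edge_sym G) xy !andbT.
  by case: (x \in R); case: (y \in R) => //= _; [right | left | left].
(* A removed vertex of degree above [k] would already cost [K]; hence no weight that counts has been
   truncated. *)
have small (x : 'I_n) : x \notin R -> deg x <= k.
  move=> xR; rewrite leqNgt; apply/negP => lt.
  have : \sum_(v in ~: R) minn (deg v) K <= k by rewrite eR.
  by rewrite (bigD1 x) ?inE //= (minn_idPr lt); lia.
apply: leq_trans le; rewrite -eR [leqRHS]big_mkcond /=.
apply: leq_sum => x _; rewrite inE.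
case: (boolP (x \in R)) => xR; first by rewrite eq_card0.
by rewrite (minn_idPl _) ?leqW ?small // deg_nbr; apply: subset_leq_card; apply/subsetP.
Qed.

(** A vertex below the threshold with a label other than [c] loses all its edges, because its
    neighbours all carry [c]. Hence the degrees of these vertices add up to at most the cut, and
    they serve as [Z] in [excess_le]. *)
Lemma degrees_complete D (g : 'I_n -> nat) (c : nat) :
  independent G (~: upper G D) ->
  (forall b, #|[set x | g x == b]| <= h) -> ecut G g <= k ->
  (forall x, x \in upper G D -> g x = c) ->
  excess n k h (fun=> 0) deg <= k.
Proof.
move=> iU hg hk gc; apply: leq_trans hk.
have inU (x y : 'I_n) : E x y -> x \notin upper G D -> y \in upper G D.
  by move=> xy xU; apply: contraTT xy => yU; apply: iU; rewrite inE.
pose P (x y : 'I_n) := [&& E x y, x \notin upper G D & g x != c].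
apply: leq_trans (@le_ecut _ _ P g _); last first.
  move=> x y /and3P[xy xU gx]; have yU := inU _ _ xy xU.
  by rewrite (gc y yU) /P yU /= andbF.
pose Z := [set x | (x \notin upper G D) && (g x != c)].
pose gn v := oapp g 0 (insub v : option 'I_n).
have gnE (x : 'I_n) : gn x = g x by rewrite /gn valK.
have le := @excess_le n k h (fun=> 0) deg Z gn (fun=> c).
apply: leq_trans (le _ _) _.
- move=> b; apply: leq_trans (hg b); apply: subset_leq_card.
  by apply/subsetP => x; rewrite !inE gnE.
- move=> x; rewrite inE negb_and negbK gnE => /orP[/gc //|/negPn/eqP -> //].
rewrite big_mkcond /=; apply: leq_sum => x _; rewrite inE.
case: ifP => [/andP[xU gx]|//]; rewrite deg_nbr; apply: subset_leq_card.
by apply/subsetP => y xy; rewrite unfold_in /P xU gx !andbT.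
Qed.

Variable D : nat.
Hypothesis cU : clique G (upper G D).
Hypothesis iU : independent G (~: upper G D).

Lemma inU (x : 'I_n) : (x \in upper G D) = (D <= deg x).
Proof. by rewrite inE deg_nbr. Qed.

Lemma edge_upper (x y : 'I_n) : E x y -> deg x < D -> D <= deg y.
Proof.
move=> xy xU; rewrite -inU; apply: contraTT xy => yU; apply: iU; rewrite inE //.
by rewrite inU -ltnNge.
Qed.

Lemma clique_upper (x y : 'I_n) : D <= deg x -> D <= deg y -> x != y -> E x y.
Proof. by rewrite -!inU; apply: cU. Qed.

Lemma rkS v : rk nbr D v.+1 = rk nbr D v + (D <= deg v).
Proof. by rewrite /rk big_ord_recr. Qed.

(** Passes from positions in the guess to clique vertices. *)
Lemma sum_rk (f : nat -> nat) v :
  \sum_(i < rk nbr D v) f i = \sum_(u < v | D <= deg u) f (rk nbr D u).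
Proof.
elim: v => [|v IH]; first by rewrite /rk !big_ord0.
rewrite rkS [in RHS]big_mkcond [in RHS]big_ord_recr /= -big_mkcond /= -IH.
by case: (D <= deg v); rewrite ?addn1 ?addn0 // big_ord_recr.
Qed.

Lemma pair_costE a (x : 'I_n) : D <= deg x ->
  pair_cost nbr D a x = #|[pred y : 'I_n |
    [&& D <= deg y, y < x & clab nbr D a y != clab nbr D a x]]|.
Proof.
move=> dx; rewrite /pair_cost dx (sum_rk (fun i => a i != a (rk nbr D x)))
  (big_ord_widen_cond n (fun u => D <= deg u)
     (fun u => (a (rk nbr D u) != a (rk nbr D x) : nat))) ?(ltnW (ltn_ord x)) //.
rewrite -sum1_card big_mkcond [RHS]big_mkcond /=; apply: eq_bigr => y _.
by rewrite inE /clab; case: (D <= deg y); case: (y < x); case: (_ != _).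
Qed.

Lemma leaf_sound a :
  (forall i, a i <= k) -> leaf n k h nbr D a <= k -> tree_free_edge_deletion G k h.
Proof.
move=> ak le.
set l := lab n nbr D a; set wv := wt n k nbr D a.
have lk v : v < n -> l v <= k.
  by move=> _; rewrite /l /lab /clab /first_lab /clab; do !case: ifP.
have [R hR eR] := @excess_kept n k h l wv lk.
set pc := \sum_(v < n) pair_cost nbr D a v in le.
set mc := \sum_(v < n) multi_cost n nbr D a v in le.
have le' : pc + mc + \sum_(v in ~: R) minn (wv v) K <= k by rewrite eR.
have small (x : 'I_n) : x \notin R -> wv x <= k.
  move=> xR; rewrite leqNgt; apply/negP => lt.
  by move: le'; rewrite (bigD1 x) ?inE //= (minn_idPr lt); lia.
pose g (x : 'I_n) := if x \in R then l x else K + x.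
have lU y : D <= deg y -> l y = clab nbr D a y by rewrite /l /lab => ->.
(* Clique vertices weigh [K], so removing one would exceed the budget. *)
have UR (x : 'I_n) : D <= deg x -> x \in R.
  by move=> dx; apply: contraTT dx => /small; rewrite /wv /wt; case: ifP => //; rewrite ltnn.
pose P (x y : 'I_n) := E x y &&
  if D <= deg x then [&& D <= deg y, y < x & l y != l x]
  else if multi nbr D a x then clab nbr D a y != a (qk n nbr D a x)
  else x \notin R.
apply: (@ecut_tfed _ _ _ _ g).
  by apply: (@kept_classes n R l K h) => // x; rewrite ltnS lk.
apply: leq_trans (@ecut_le _ _ P g _) _.
  have half (x y : 'I_n) : E x y -> deg x < D -> g x != g y -> P x y.
    move=> xy dx; have dy := edge_upper xy dx.
    have Dd : (D <= deg x) = false by rewrite leqNgt dx.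
    rewrite /P xy Dd /= /g (UR y dy) (lU y dy).
    have d0 : 0 < deg x by rewrite deg_nbr; apply/card_gt0P; exists y.
    case: (boolP (multi nbr D a x)) => mx.
      have lx : l x = a (qk n nbr D a x).
        by rewrite /l /lab Dd gtn_eqF //= mx.
      case: (boolP (x \in R)) => xR; first by rewrite lx eq_sym.
      (* A removed vertex that sees two labels has weight 0: no neighbour carries its guessed label,
         and [multi_cost] has already paid for all its edges. *)
      move=> _; have := small x xR; rewrite /wv /wt Dd mx.
      case: ltnP => [_|ge _]; first by rewrite ltnn.
      have eqs : mism nbr (clab nbr D a) x (a (qk n nbr D a x)) == size (nbr x).
        by rewrite eqn_leq count_size.
      by move: eqs; rewrite -all_count => /allP/(_ y); rewrite mem_nbr; apply.
    case: (boolP (x \in R)) => // xR.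
    have -> : l x = first_lab nbr D a x.
      by rewrite /l /lab Dd gtn_eqF //= (negbTE mx).
    (* A kept vertex that sees a single label shares it with all its neighbours, so none of its
       edges is cut. *)
    move: mx; rewrite /multi dx d0 /= -leqNgt leqn0 => mx.
    have /hasPn/(_ (val y)) : ~~ has (fun z => clab nbr D a z != first_lab nbr D a x) (nbr x).
      by rewrite has_count -leqNgt leqn0.
    by rewrite mem_nbr => /(_ xy); rewrite negbK => /eqP ->; rewrite eqxx.
  move=> x y xy gxy.
  have [dx|dx] := ltnP (deg x) D; first by left; apply: half.
  have [dy|dy] := ltnP (deg y) D.
    by right; apply: half => //; rewrite 1?(edge_sym G) // eq_sym.
  move: gxy; rewrite /g !UR // /P xy (edge_sym G) xy dx dy /= => ne.
  have : val x != y by apply: contraTneq xy => /val_inj ->; rewrite (edge_irr G).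
  by rewrite neq_ltn => /orP[lt|lt]; [right|left]; rewrite lt ?ne // eq_sym.
apply: leq_trans le'; rewrite /pc /mc -big_split [X in _ + X]big_mkcond /= -big_split /=.
apply: leq_sum => x _; rewrite inE.
have [dx|dx] := ltnP (deg x) D; last first.
  apply: leq_trans (leq_addr _ _); apply: leq_trans (leq_addr _ _).
  rewrite pair_costE //; apply: subset_leq_card; apply/subsetP => y.
  rewrite unfold_in /P dx => /andP[_ /and3P[dy lt ne]].
  by rewrite inE dy lt -!lU.
have Dd : (D <= deg x) = false by rewrite leqNgt dx.
have [mx|mx] := boolP (multi nbr D a x).
  apply: leq_trans (leq_addr _ _); apply: leq_trans (leq_addl _ _).
  rewrite /multi_cost mx /mism count_nbr; apply: subset_leq_card.
  by apply/subsetP => y; rewrite unfold_in /P Dd /= mx.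
apply: leq_trans (leq_addl _ _).
case: (boolP (x \in R)) => xR.
  by rewrite eq_card0 // => y; rewrite unfold_in /P Dd (negbTE mx) xR andbF.
have wE : wv x = deg x by rewrite /wv /wt Dd (negbTE mx).
rewrite (minn_idPl _); last by rewrite leqW ?small.
rewrite wE deg_nbr; apply: subset_leq_card; apply/subsetP => y.
by rewrite unfold_in /P => /andP[].
Qed.

Lemma leaf_complete (g : 'I_n -> nat) (u0 w0 : 'I_n) :
  (forall c, #|[set x | g x == c]| <= h) -> ecut G g <= k ->
  D <= deg u0 -> D <= deg w0 -> g u0 != g w0 ->
  #|upper G D| <= K /\
  exists2 x, x < K ^ k & leaf n k h nbr D (digit k x) <= k.
Proof.
move=> hg hk du dw guw.
pose gn v := oapp g 0 (insub v : option 'I_n).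
have gnE (x : 'I_n) : gn x = g x by rewrite /gn valK.
pose Ts := [seq v <- iota 0 n | D <= deg v].
pose s := [seq gn v | v <- Ts].
(* [R v] equals [size s] when no clique vertex has the label of [v]. *)
pose R v := index (gn v) s.
pose M v := [&& deg v < D, 0 < deg v & 0 < mism nbr R v (R (head 0 (nbr v)))].
pose Ms := [seq v <- iota 0 n | M v].
(* The digits in the order in which the program consumes them: clique vertices, then the vertices
   that see two labels. *)
pose a := nth 0 [seq R v | v <- Ts ++ Ms].
have sTs : size Ts = rk nbr D n by rewrite size_filter count_iota.
have sMs : size Ms = \sum_(v < n) (M v : nat) by rewrite size_filter count_iota.
have ss : size s = rk nbr D n by rewrite size_map.
have inS (x : 'I_n) : D <= deg x -> gn x \in s.
  by move=> dx; apply: map_f; rewrite mem_filter dx mem_iota /=.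
have RE y z : gn y \in s -> (R z == R y) = (gn z == gn y).
  move=> ys; apply/eqP/eqP => [e|]; last by rewrite /R => ->.
  have zs : gn z \in s by rewrite -index_mem -/(R z) e index_mem.
  by rewrite -(nth_index 0 ys) -(nth_index 0 zs) -/(R z) -/(R y) e.
have aT v : v < n -> D <= deg v -> a (rk nbr D v) = R v.
  move=> vn dv; have lt : rk nbr D v < size Ts.
    have := rk_mono nbr D vn; rewrite rkS dv sTs; lia.
  rewrite /a (nth_map 0) ?size_cat; last by apply: leq_trans lt (leq_addr _ _).
  by rewrite nth_cat lt nth_filter_iota.
have hdin v : 0 < deg v -> head 0 (nbr v) \in nbr v.
  by move=> d0; rewrite -nth0 mem_nth.
have nbT (x : 'I_n) v : v \in nbr x -> deg x < D ->
    exists y : 'I_n, [/\ v = y, E x y & D <= deg y].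
  by move=> /nbrP[y xy ->] dx; exists y; split=> //; apply: edge_upper xy dx.
(* Of two neighbours with different labels, at least one disagrees with [x]. *)
have cut_g (x : 'I_n) : M x -> exists2 y : 'I_n, E x y & g x != g y.
  move=> /and3P[dx d0 m0].
  have [z [ez xz dz]] := nbT x _ (hdin _ d0) dx.
  move: m0; rewrite -has_count => /hasP[v vx].
  have [y [-> xy dy]] := nbT _ _ vx dx; rewrite ez RE ?inS // !gnE => ne.
  have [e|ne'] := eqVneq (g x) (g z); last by exists z.
  by exists y => //; rewrite e eq_sym.
(* [phi] picks pairwise distinct cut edges, one for each clique vertex but [u0] and
   one for each vertex of [M]; this bounds the number of digits. *)
pose phi (x : 'I_n) := if D <= deg x then (if g x != g u0 then u0 else w0)
  else odflt x [pick y | E x y && (g x != g y)].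
have phiM (x : 'I_n) : M x -> [/\ E x (phi x), g x != g (phi x) & D <= deg (phi x)].
  move=> mx; have /and3P[dx _ _] := mx; rewrite /phi leqNgt dx /=.
  case: pickP => [y /andP[xy gxy]|no]; first by split=> //; apply: edge_upper xy dx.
  by have [y xy gxy] := cut_g x mx; have := no y; rewrite xy gxy.
have phiT (x : 'I_n) : D <= deg x -> x != u0 ->
    [/\ E x (phi x), g x != g (phi x) & D <= deg (phi x)].
  move=> dx xu; rewrite /phi dx; case: ifPn => [ne|]; first by split=> //; apply: clique_upper.
  rewrite negbK => /eqP e; split; rewrite ?e //; apply: clique_upper => //.
  by apply: contraNneq guw => <-; rewrite e.
pose dom (x : 'I_n) := ((D <= deg x) && (x != u0)) || M x.
have phiP x : dom x -> [/\ E x (phi x), g x != g (phi x) & D <= deg (phi x)].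
  by case/orP => [/andP[dx xu]|mx]; [apply: phiT | apply: phiM].
have nMT (x : 'I_n) : D <= deg x -> M x = false by rewrite /M ltnNge => ->.
have szK : size (Ts ++ Ms) <= K.
  apply: leq_trans (_ : (\sum_x #|(fun y => dom x && (y == phi x)) : pred 'I_n|).+1 <= _);
    last first.
    apply: leq_trans hk; apply: (@le_ecut _ _ (fun x y => dom x && (y == phi x))).
    (* An edge chosen from both ends would join [u0] and [w0], but [u0] is outside [dom]. *)
    move=> x y /andP[dx /eqP ->]; have [xy gxy dp] := phiP x dx; split=> //.
    apply/negP => /andP[dp' /eqP ex].
    have [_ _ dx'] := phiP _ dp'; rewrite -ex in dx'.
    have nu : phi x != u0.
      by case/orP: dp' => [/andP[] //|]; rewrite nMT.
    have xw : x = w0 \/ x = u0.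
      by rewrite ex {1 3}/phi dp; case: ifP => _; [right|left].
    have pw : phi x = w0.
      by move: nu; rewrite /phi dx'; case: ifP; rewrite ?eqxx.
    case: xw => exu.
      by rewrite pw exu (edge_irr G) in xy.
    by case/orP: dx => [/andP[_]|]; rewrite ?exu ?eqxx // nMT.
  have -> : \sum_x #|(fun y => dom x && (y == phi x)) : pred 'I_n| = \sum_(x < n) (dom x : nat).
    apply: eq_bigr => x _; case: (dom x) => /=; first by rewrite -(card1 (phi x)).
    by rewrite eq_card0.
  have -> : \sum_(x < n) (dom x : nat) =
      \sum_(x < n) ((D <= deg x) && (x != u0) : nat) + \sum_(x < n) (M x : nat).
    rewrite -big_split /=; apply: eq_bigr => x _; rewrite /dom.
    by case: (boolP (D <= deg x)) => [/nMT ->|]; rewrite ?orbF ?addn0.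
  (* The clique vertex [u0], which chooses no edge, accounts for the successor. *)
  rewrite size_cat sTs sMs -addSn leq_add2r /rk (bigD1 u0) //= du add1n ltnS.
  rewrite big_mkcond /=; apply: leq_sum => x _.
  by case: (x != u0); rewrite ?andbT ?andbF.
split.
  apply: leq_trans szK; rewrite size_cat sTs; apply: leq_trans (leq_addr _ _).
  rewrite -sum1_card big_mkcond /=; apply: leq_sum => x _.
  by rewrite inU; case: ifP.
have m_gt0 : 0 < rk nbr D n.
  by have := rk_mono nbr D (ltn_ord u0); rewrite rkS du; lia.
have Tslt v : v \in Ts -> gn v \in s by move=> vT; apply: map_f.
have a_le i : a i <= k.
  have [ge|lt] := leqP (size (Ts ++ Ms)) i.
    by rewrite /a nth_default // size_map.
  have : a i \in [seq R v | v <- Ts ++ Ms] by rewrite mem_nth // size_map.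
  case/mapP => v; rewrite mem_cat => /orP[vT|vM] ->.
    have := Tslt v vT; rewrite -index_mem -/(R v) ss => lt'.
    by rewrite -ltnS; apply: leq_trans lt' _; move: szK; rewrite size_cat sTs; lia.
  (* The number [size s] of a label absent from the clique arises only if [Ms] is nonempty, and then
     [szK] still leaves room for it. *)
  have : R v <= size s by apply: index_size.
  have : 0 < size Ms by rewrite lt0n size_eq0; apply: contraTneq vM => ->.
  by move: szK; rewrite size_cat sTs ss; lia.
have a_0 : a 0 = 0.
  move: m_gt0; rewrite -sTs /a /R /s; case E: Ts => [//|t ts] _ /=.
  by rewrite eqxx.
(* The shift by one leaves out digit 0, which is fixed and agrees with [a_0]. *)
have [x xK hx] := digits_exist k (fun i => a_le i.+1).
exists x => //; set b := digit k x.
have bE i : b i = a i.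
  case: i => [|i]; first by rewrite a_0.
  rewrite /b /digit hx; case: ltnP => // ki.
  by rewrite /a nth_default // size_map; apply: leq_trans szK _.
have cT v : v < n -> D <= deg v -> clab nbr D b v = R v.
  by move=> vn dv; rewrite /clab bE aT.
have cR (y : 'I_n) v : v \in nbr y -> deg y < D -> clab nbr D b v = R v.
  by move=> vy dy; have [z [-> _ dz]] := nbT _ _ vy dy; rewrite cT.
have mE (y : 'I_n) c : deg y < D -> mism nbr (clab nbr D b) y c = mism nbr R y c.
  by move=> dy; apply: eq_in_count => v vy; rewrite (cR y).
have multiE (y : 'I_n) : multi nbr D b y = M y.
  rewrite /multi /M; case: ltnP => //= dy; case: (ltnP 0 (deg y)) => //= d0.
  by rewrite mE // /first_lab (cR y) ?hdin.
have qkE (y : 'I_n) : qk n nbr D b y = rk nbr D n + \sum_(u < y) (M u : nat).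
  congr (_ + _); apply: eq_bigr => u _.
  by rewrite -(multiE (Ordinal (ltn_trans (ltn_ord u) (ltn_ord y)))).
have bM (y : 'I_n) : M y -> b (qk n nbr D b y) = R y.
  move=> my; rewrite qkE bE.
  have lt : \sum_(u < y) (M u : nat) < size Ms.
    rewrite sMs -!count_iota.
    have -> : iota 0 n = iota 0 (y + (n - y.+1).+1) by congr iota; have := ltn_ord y; lia.
    by rewrite iotaD count_cat /= my; lia.
  rewrite /a (nth_map 0) ?size_cat ?sTs ?ltn_add2l //.
  by rewrite nth_cat sTs ltnNge leq_addr addKn nth_filter_iota.
apply: leq_trans hk.
pose P (y z : 'I_n) := [&& E y z, g y != g z, D <= deg z & (D <= deg y) ==> (z < y)].
apply: leq_trans (@le_ecut _ _ P g _); last first.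
  move=> y z /and4P[yz gyz dz /implyP h1]; split=> //.
  apply/negP => /and4P[_ _ dy /implyP h2].
  by have := h1 dy; have := h2 dz; lia.
(* The vertices that [g] separates from the common label of their neighbours. *)
pose Z := [set y : 'I_n | [&& deg y < D, ~~ M y & R y != lab n nbr D b y]].
have hgn c : #|[set v : 'I_n | gn v == c]| <= h.
  apply: leq_trans (hg c); apply: subset_leq_card.
  by apply/subsetP => v; rewrite !inE gnE.
have headR (v : 'I_n) : deg v < D -> 0 < deg v -> ~~ M v ->
    lab n nbr D b v = R (head 0 (nbr v)).
  move=> dv d0 mv; rewrite /lab leqNgt dv /= gtn_eqF // multiE (negbTE mv).
  by rewrite /first_lab (cR v) ?hdin.
have exc := @excess_le n k h (lab n nbr D b) (wt n k nbr D b) Z gn (nth 0 s) hgn.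
have {exc} exc : excess n k h (lab n nbr D b) (wt n k nbr D b) <=
    \sum_(v in Z) wt n k nbr D b v.
  apply: exc => v vZ; have [dv|dv] := leqP D (deg v).
    by move=> _; rewrite /lab dv cT // nth_index ?inS.
  have Dd : (D <= deg v) = false by rewrite leqNgt dv.
  move: vZ; rewrite inE dv /=; have [mv|mv] := boolP (M v).
    move=> _; rewrite /wt Dd multiE mv bM // mE //.
    (* Positive weight gives a neighbour with the number of [v]. So this number stands for a label
       of the clique, and [nth 0 s] recovers it. *)
    case: (ltnP (mism nbr R v (R v))) => // lt _.
    rewrite /lab Dd multiE mv bM //; case/and3P: (mv) => _ /gtn_eqF -> _.
    have : ~~ all (fun y => R y != R v) (nbr v).
      by rewrite all_count neq_ltn; apply/orP; left; apply: lt.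
    case/allPn => y yv /negPn/eqP Ry; have [z [ez _ dz]] := nbT _ _ yv dv.
    have gz : gn z \in s by apply: inS.
    have gvz : gn v = gn z by apply/eqP; rewrite -RE // -Ry ez.
    by rewrite nth_index ?gvz.
  move=> /negPn/eqP Rl; rewrite /wt Dd multiE (negbTE mv) => d0.
  have [z [ez _ dz]] := nbT _ _ (hdin _ d0) dv.
  rewrite -Rl nth_index // -index_mem -/(R v) Rl headR // ez index_mem; exact: inS.
rewrite /leaf; apply: leq_trans (leq_add (leqnn _) exc) _.
rewrite -big_split [X in _ + X]big_mkcond /= -big_split /=; apply: leq_sum => y _.
rewrite inE /multi_cost multiE.
have [dy|dy] := leqP D (deg y).
  rewrite nMT //= !addn0 pair_costE //; apply: subset_leq_card; apply/subsetP => z.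
  rewrite inE => /and3P[dz zy]; rewrite !cT // RE ?inS // !gnE => ne.
  rewrite unfold_in /P dz zy implybT eq_sym ne !andbT; apply: clique_upper => //.
  by rewrite -val_eqE /= gtn_eqF.
have Dd : (D <= deg y) = false by rewrite leqNgt dy.
rewrite /pair_cost Dd add0n; have [my|my] := boolP (M y).
  rewrite addn0 bM // mE // /mism count_nbr; apply: subset_leq_card.
  apply/subsetP => z; rewrite inE => /andP[yz ne].
  rewrite unfold_in /P yz Dd /= (edge_upper yz dy) !andbT.
  by apply: contraNneq ne => e; rewrite /R !gnE e.
rewrite add0n; case: ifP => //= ne.
rewrite /wt Dd multiE (negbTE my) deg_nbr; apply: subset_leq_card; apply/subsetP => z yz.
have d0 : 0 < deg y by rewrite deg_nbr; apply/card_gt0P; exists z.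
rewrite unfold_in /P [E y z]yz Dd (edge_upper yz dy) /= andbT.
apply: contraTneq ne => e; rewrite headR // negbK.
have -> : R y = R z by rewrite /R !gnE e.
move: my; rewrite /M dy d0 /= -leqNgt leqn0 => /eqP m0.
have /hasPn/(_ (val z)) : ~~ has (fun v => R v != R (head 0 (nbr y))) (nbr y).
  by rewrite has_count -leqNgt leqn0 -/(mism _ _ _ _) m0.
by rewrite mem_nbr => /(_ yz); rewrite negbK.
Qed.

End Instance.

(** * From the two tests to the answer *)

Section Decision.

Variables (n : nat) (G : sgraph n) (adj : 'I_n -> seq 'I_n) (k h : nat).
Hypothesis adjP : adjacency_lists G adj.
Hypothesis h_gt0 : 0 < h.
Local Notation nb := (nbr adj).
Local Notation E := (edge G).

Lemma deg_lower D (x : 'I_n) : independent G (~: upper G D) -> deg nb x < D ->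
  deg nb x <= #|upper G D|.
Proof.
move=> iU dx; rewrite (deg_nbr adjP); apply: subset_leq_card; apply/subsetP => y xy.
by rewrite (inU adjP); apply: edge_upper xy dx.
Qed.

Lemma thr_ok_lower D v : thr_ok n k nb D -> v < n -> deg nb v < D ->
  deg nb v <= k.+1 /\ {in nb v, forall y, D <= deg nb y}.
Proof.
move=> /(thr_okP adjP)[_ iU leK] vn; rewrite -[v]/(val (Ordinal vn)) => dv.
split; first by apply: leq_trans leK; apply: deg_lower.
by move=> y /(nbrP adjP)[z vz ->]; apply: edge_upper vz dv.
Qed.

Lemma constant_upper D (g : 'I_n -> nat) :
  (exists c, forall x, x \in upper G D -> g x = c) \/
  exists u v : 'I_n, [/\ D <= deg nb u, D <= deg nb v & g u != g v].
Proof.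
have [->|/set0Pn[x0 x0U]] := eqVneq (upper G D) set0.
  by left; exists 0 => x; rewrite inE.
case: (boolP [forall x in upper G D, g x == g x0]) => [/forall_inP all|].
  by left; exists (g x0) => x /all/eqP.
rewrite negb_forall_in => /exists_inP[x xU ne]; right.
by exists x, x0; rewrite -!(inU adjP).
Qed.

Lemma decision (r : bool) : split_graph G ->
  (r -> excess n k h (fun=> 0) (deg nb) <= k \/
      exists2 D, thr_ok n k nb D & exists x, leaf n k h nb D (digit k x) <= k) ->
  (~~ r -> k < excess n k h (fun=> 0) (deg nb) /\
      ((forall D, D < k.+3 -> ~~ thr_ok n k nb D) \/
       exists2 D, thr_ok n k nb D &
         forall x, x < k.+1 ^ k -> k < leaf n k h nb D (digit k x))) ->
  tree_free_edge_deletion G k h = r.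
Proof.
move=> sG; case: r => [/(_ isT) yes _|_ /(_ isT)[noA noL]].
  case: yes => [|[D /(thr_okP adjP)[cU iU _] [x]]]; first exact: degrees_sound.
  by apply: leaf_sound => // i; rewrite -ltnS digit_lt.
apply/negbTE/negP => /tfed_ecut[g hg hk].
(* Since the degree test failed, [g] takes two values on the clique. *)
have key D : clique G (upper G D) -> independent G (~: upper G D) ->
    #|upper G D| <= k.+1 /\
    exists2 x, x < k.+1 ^ k & leaf n k h nb D (digit k x) <= k.
  move=> cU iU; have [[c hc]|[u [v [du dv guv]]]] := constant_upper D g.
    by move: noA; rewrite ltnNge (degrees_complete adjP iU hg hk hc).
  by apply: leaf_complete hg hk du dv guv.
case: noL => [no|[D /(thr_okP adjP)[cU iU _] no]]; last first.
  by have [_ [x xK]] := key D cU iU; rewrite leqNgt no.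
have [D [cU iU]] := split_threshold sG.
have [leK _] := key D cU iU.
(* A vertex below [D] has at most [k + 1] neighbours, so lowering the threshold to [k + 2] selects
   the same set. This is why [k + 3] candidates suffice. *)
have eU : upper G (minn D k.+2) = upper G D.
  apply/setP => x; rewrite !(inU adjP) geq_min; case: (leqP D (deg nb x)) => //= dx.
  by apply/negbTE; rewrite -ltnNge ltnS; apply: leq_trans leK; apply: deg_lower.
have /negP := no (minn D k.+2) ltac:(lia); apply.
by apply/(thr_okP adjP); rewrite eU.
Qed.

End Decision.

(** * The input *)

Section Encoding.

Variables (lists : seq (seq nat)) (k h : nat).
Local Notation n := (size lists).
Local Notation input := (encode lists k h).
Local Notation ptr v := (n + 4 + sumn (take v (shape lists))).

Lemma size_encode : size input = ptr n.
Proof.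
rewrite /encode !size_cat size_map size_iota size_flatten.
by rewrite take_oversize ?size_map //=; lia.
Qed.

Lemma encode_ptr v : v <= n -> nth 0 input (v + 3) = ptr v.
Proof.
move=> vn; rewrite /encode nth_cat ifF; last by rewrite /=; lia.
rewrite [_ - _](_ : _ = v); last by rewrite /=; lia.
rewrite nth_cat size_map size_iota ltnS vn.
by rewrite (nth_map 0) ?size_iota // nth_iota.
Qed.

Lemma sumn_take_shape v : v < n ->
  sumn (take v.+1 (shape lists)) =
  sumn (take v (shape lists)) + size (nth [::] lists v).
Proof.
move=> vn; rewrite (take_nth 0) ?size_map // -cats1 sumn_cat /= addn0.
by rewrite (nth_map [::]).
Qed.

Lemma sumn_take_le v : sumn (take v (shape lists)) <= sumn (take n (shape lists)).
Proof.
rewrite [in leqRHS]take_oversize ?size_map // -{2}(cat_take_drop v (shape lists)).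
by rewrite sumn_cat leq_addr.
Qed.

Lemma encode_list v e : v < n -> e < size (nth [::] lists v) ->
  nth 0 input (nth 0 input (v + 3) + e) = nth 0 (nth [::] lists v) e.
Proof.
move=> vn en; transitivity (nth 0 input (ptr v + e)).
  by congr (nth 0 input (_ + e)); apply: encode_ptr (ltnW vn).
rewrite /encode.
rewrite nth_cat ifF; last by rewrite /=; lia.
rewrite nth_cat size_map size_iota ifF; last by rewrite /=; lia.
have -> : flatten lists = flatten (take v lists) ++ flatten (drop v lists).
  by rewrite -flatten_cat cat_take_drop.
have sz : size (flatten (take v lists)) = sumn (take v (shape lists)).
  by rewrite size_flatten /shape map_take.
rewrite nth_cat sz ifF; last by rewrite /=; lia.
rewrite (drop_nth [::] vn) /= nth_cat ifT; last by lia.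
by congr nth; lia.
Qed.

End Encoding.

(** * Running the program *)

(** The length of the input is not given separately: it is the last pointer, in cell [n + 3]. *)
Definition prologue :=
  [:: IConst tmp_reg 0; ILoad tmp_reg.+1 tmp_reg; IConst tmp_reg.+2 3;
      IOp OAdd tmp_reg.+1 tmp_reg.+1 tmp_reg.+2; ILoad base_reg tmp_reg.+1].

Definition epilogue q :=
  [:: IConst tmp_reg 0; IJumpLt tmp_reg r_res q.+4; IHalt false; IHalt false; IHalt true].

Definition split_program : program :=
  prologue ++ comp main_cmd 5 ++ epilogue (5 + csz main_cmd).

(** Every monomial of the cost is at most [K ^ k * K * K * n], as [K] and [n] are positive, and 3000
    is a crude constant that absorbs the coefficients. The 7 pays for prologue and epilogue. *)
Lemma cost_main_cmd : exists C, forall n k, 0 < n ->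
  cost (bounds n k) main_cmd + 7 <= C * k.+1 ^ k.+2 * n.
Proof.
exists 3000 => n k n0; rewrite expnS expnS.
rewrite /main_cmd /search_cmd /leaf_cmd /rest_cmd /mism_cmd /clique_cmd /excess_cmd
    /accept_cmd /next_cmd /threshold_cmd /degree_cmd /For /IfEq /Incr /degE.
cbn [cost esz].
change (bounds n k 0) with n; change (bounds n k 1) with k.+1.
change (bounds n k 3) with (k.+1 ^ k).
have -> : bounds n k 2 = k.+1 + 2 by rewrite addn2.
have P0 : 0 < k.+1 ^ k by rewrite expn_gt0.
move: (k.+1 ^ k) P0 (ltn0Sn k) => P P0; move: k.+1 => K K0.
have q1 : n <= K * n by apply: leq_pmull.
have q2 : K * n <= K * K * n by rewrite -mulnA leq_pmull.
have q3 : K <= K * K by apply: leq_pmull.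
have q4 : K * K <= K * K * n by apply: leq_pmulr.
have p1 x : x <= K * K * n -> P * x <= P * (K * K * n) by move=> le; apply: leq_mul.
have p2 : K * K * n <= P * (K * K * n) by apply: leq_pmull.
have := p1 1; have := p1 n; have := p1 K; have := p1 (K * n); have := p1 (K * K).
move: p2; set Q := P * (K * K * n).
have -> : 3000 * (K * (K * P)) * n = 3000 * Q by rewrite /Q; lia.
lia.
Qed.

Lemma wf_main : wfc main_cmd.
Proof. by []. Qed.

Lemma code_at_mid (c1 c2 c3 : seq instr) : code_at (c1 ++ c2 ++ c3) c2 (size c1).
Proof.
move=> i hi; rewrite nth_cat ifF; last by lia.
by rewrite nth_cat addKn hi.
Qed.

Lemma run_split_program w (input : seq nat) (s1 : store) (r : bool) t :
  3 < size input -> (forall x, x \in input -> x < 2 ^ w) ->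
  (nth 0 input 0) + 3 < 2 ^ w ->
  nth 0 input (nth 0 input 0 + 3) = size input ->
  exec w (size input) (nth 0 input) main_cmd
    (Store (fun=> 0) (fun _ _ => 0)) s1 t ->
  reg s1 r_res = r ->
  halts_within w split_program input (5 + t + 2) r.
Proof.
move=> sz small nW lenE ex er.
set W := 2 ^ w in small nW.
have W3 : 3 < W by lia.
pose m := nth 0 input.
have mW i : m i < W.
  rewrite /m; have [lt|ge] := ltnP i (size input); first by apply/small/mem_nth.
  by rewrite nth_default; lia.
have cd := @code_at_mid prologue (comp main_cmd 5) (epilogue (5 + csz main_cmd)).
have cp : code_at split_program prologue 0 by apply: (@code_at_mid [::]).
have ce : code_at split_program (epilogue (5 + csz main_cmd)) (5 + csz main_cmd).
  have := @code_at_mid (prologue ++ comp main_cmd 5) (epilogue (5 + csz main_cmd)) [::].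
  by rewrite cats0 -catA size_cat size_comp.
pose r0 : nat -> nat := update (update (update (update (update (fun=> 0) 31 0) 32 (m 0)) 33 3) 32 (m 0 + 3)) 30 (size input).
have pro : iter 5 (step w split_program) (init input) = State 5 r0 m.
  move: cp => /code_at_cons[h1 /code_at_cons[h2 /code_at_cons[h3 /code_at_cons[h4 /code_at_cons[h5 _]]]]].
  rewrite /init iterSr (step1 _ _ _ h1) iterSr (step1 _ _ _ h2) iterSr (step1 _ _ _ h3).
  rewrite iterSr (step1 _ _ _ h4) iterSr (step1 _ _ _ h5) /=.
  rewrite /eval_op !(updE, updN) // mod0n (@modn_small 3) // modn_small //.
  by rewrite lenE.
have R0 : sim w (size input) m (Store (fun=> 0) (fun _ _ => 0)) r0 m.
  split=> //.
  - move=> x hx; rewrite /r0 /update /=; do ![case: eqP => [e|_]; first by rewrite e in hx].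
    by split=> //; lia.
  - by move=> t' i _; rewrite /m nth_default /=; [split=> //; lia | lia].
have [r1 [m1 [run R1]]] := comp_correct ex cd wf_main R0 (ltn_trans (isT : 1 < 2) (ltn_trans (isT : 2 < 3) W3)).
have [R1r _ _ _] := R1.
have r14 : r1 14 = r by have [-> _] := R1r 14 isT.
move: ce => /code_at_cons[h1 /code_at_cons[h2 /code_at_cons[h3 /code_at_cons[h4 /code_at_cons[h5 _]]]]].
rewrite /halts_within -addnA (steps_trans pro (steps_trans run (erefl _))).
rewrite iterSr (step1 _ _ _ h1) iterSr (step1 _ _ _ h2) !(updE, updN) // r14 mod0n.
by case: r er r14 => _ _ /=; [apply: h5 | apply: h3].
Qed.

Section InstanceInput.

Variables (n : nat) (adj : 'I_n -> seq 'I_n) (k h : nat).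
Local Notation lists := [seq [seq val y | y <- adj x] | x <- enum 'I_n].
Local Notation input := (encode_instance adj k h).

Lemma size_lists : size lists = n.
Proof. by rewrite size_map size_enum_ord. Qed.

Lemma nth_lists v : v < n -> nth [::] lists v = nbr adj v.
Proof.
move=> vn; rewrite (nth_map (Ordinal vn)) ?size_enum_ord //.
rewrite -[v in RHS]/(val (Ordinal vn)) nbr_val; congr map; congr adj.
by apply: val_inj; rewrite /= nth_enum_ord.
Qed.

Lemma input_ptrS v : v < n ->
  nth 0 input (v + 4) = nth 0 input (v + 3) + deg (nbr adj) v.
Proof.
move=> vn; have vl : v < size lists by rewrite size_lists.
have -> : v + 4 = v.+1 + 3 by lia.
rewrite (encode_ptr _ _ vl) (encode_ptr _ _ (ltnW vl)) sumn_take_shape //.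
by rewrite nth_lists // addnA.
Qed.

Lemma input_nbr v e : v < n -> e < deg (nbr adj) v ->
  nth 0 input (nth 0 input (v + 3) + e) = nth 0 (nbr adj v) e.
Proof.
move=> vn en; rewrite -nth_lists //; apply: encode_list; rewrite ?size_lists //.
by rewrite nth_lists.
Qed.

Lemma input_ptr_n : nth 0 input (n + 3) = size input.
Proof.
by rewrite [RHS]size_encode -[n in n + 3]size_lists; apply: encode_ptr.
Qed.

Lemma input_ptr_le v : v < n ->
  nth 0 input (v + 3) + deg (nbr adj) v <= size input.
Proof.
move=> vn; have vl : v < size lists by rewrite size_lists.
rewrite -input_ptrS // (_ : v + 4 = v.+1 + 3); last by lia.
rewrite (encode_ptr _ _ vl) [leqRHS]size_encode leq_add2l.
exact: sumn_take_le.
Qed.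

Lemma input_n : nth 0 input 0 = n.
Proof. exact: size_lists. Qed.

Lemma size_input : n + 4 <= size input.
Proof. by rewrite [leqRHS]size_encode size_lists leq_addr. Qed.

(** With [N] the length plus the largest entry, all quantities are polynomials in [N] of degree at
    most 3. The fourth power leaves a factor [N], at least 5, to absorb their coefficients; four
    cells are always present and [0 < k] supplies the fifth unit. *)
Lemma word_bounds w : 0 < k -> word_size_ok 4 w input ->
  [/\ forall x, x \in input -> x < 2 ^ w,
      size input + 6 * n + 6 * k + 6 * h + 30 < 2 ^ w &
      n * k.+1 + n * n + n * n + k.+1 * (k.+1 * n) + n < 2 ^ w].
Proof.
move=> k0; rewrite /word_size_ok; have := size_input.
have mx x : x \in input -> x <= \max_(x <- input) x.
  by move=> xi; apply: (@leq_bigmax_seq _ input xpredT id x xi).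
have := mx k; have := mx h; rewrite !inE !eqxx !orbT => /(_ isT) hh /(_ isT) hk.
move: (\max_(x <- input) x) mx hh hk => m mx hh hk.
move: (size input) => L hL; set N := L + m => hW.
have N5 : 5 <= N by rewrite /N; lia.
have e4 : N ^ 4 = N * (N * (N * N)) by rewrite !expnS expn0 muln1.
have h2 : 5 * N <= N * N by rewrite leq_mul2r N5 orbT.
have h3 : 5 * (N * N) <= N * (N * N) by rewrite leq_mul2r N5 orbT.
have h4 : 5 * (N * (N * N)) <= N * (N * (N * N)) by rewrite leq_mul2r N5 orbT.
rewrite e4 in hW.
have nN : n <= N by rewrite /N; lia.
have kN : k.+1 <= N by rewrite /N; lia.
have hN : h <= N by rewrite /N; lia.
have LN : L <= N by rewrite /N; lia.
have m1 : n * k.+1 <= N * N by apply: leq_mul.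
have m2 : n * n <= N * N by apply: leq_mul.
have m3 : k.+1 * (k.+1 * n) <= N * (N * N) by rewrite !leq_mul.
split.
- move=> x /mx xm; have xN : x <= N by rewrite /N; lia.
  by lia.
- by lia.
- by lia.
Qed.

End InstanceInput.

Lemma split_program_correct : exists C, forall n (G : sgraph n)
    (adj : 'I_n -> seq 'I_n) k h w,
  split_graph G -> adjacency_lists G adj -> 0 < k -> 0 < h ->
  word_size_ok 4 w (encode_instance adj k h) ->
  exists t, halts_within w split_program (encode_instance adj k h) t
              (tree_free_edge_deletion G k h) /\
            (0 < n -> t <= C * k.+1 ^ k.+2 * n).
Proof.
have [C hC] := cost_main_cmd; exists C => n G adj k h w sG adjP k0 h0 wok.
have [small W1 W2] := word_bounds k0 wok.
set input := encode_instance adj k h in wok small W1 W2 *.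
have nthV v e : v < n -> e < deg (nbr adj) v -> nth 0 (nbr adj v) e \in nbr adj v.
  by move=> _; apply: mem_nth.
have nb_lt v e : v < n -> e < deg (nbr adj) v -> nth 0 (nbr adj v) e < n.
  move=> vn en; have := nthV v e vn en; rewrite -[v in nbr adj v]/(val (Ordinal vn)).
  by case/(nbrP adjP) => y _ ->.
have deg_le v : v < n -> deg (nbr adj) v <= n.
  by move=> vn; rewrite -[v]/(val (Ordinal vn)); apply: (deg_le_n adjP).
have [s1 [t [ex le [r [er yes no]]]]] :=
  @main_cmdP n k h w (size input) (nbr adj) (nth 0 input)
    (input_n adj k h) erefl erefl (@input_ptrS n adj k h) (@input_nbr n adj k h)
    (@input_ptr_le n adj k h) (size_input adj k h) nb_lt deg_le W1 W2
    (Store (fun=> 0) (fun _ _ => 0)) (fun _ => erefl) (fun _ _ => erefl)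
    (fun D ok v => @thr_ok_lower n G adj k adjP D v ok).
exists (5 + t + 2); split; last first.
  by move=> n0; apply: leq_trans (hC n k n0); lia.
rewrite (decision adjP h0 sG yes no).
apply: run_split_program ex er => //.
- by rewrite [nth 0 input 0]input_n; lia.
- by rewrite input_n input_ptr_n.
Qed.

(* The time bound over the reals *)
From HB Require Import structures.
From mathcomp Require Import all_boot all_order all_algebra.
From mathcomp Require Import all_classical all_reals all_analysis.
Import Order.TTheory GRing.Theory Num.Theory.
Import numFieldNormedType.Exports.
Local Open Scope classical_set_scope.
Local Open Scope ring_scope.

Theorem theorem8 (R : realType) :
  exists (P : program) (c : nat) (M : R) (eps : nat -> R),
    [/\ (0 < c)%N,
        eps @ \oo --> (0 : R) &
        forall (n : nat) (G : sgraph n) (adj : 'I_n -> seq 'I_n) (k h w : nat),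
          split_graph G -> adjacency_lists G adj ->
          (0 < k)%N -> (0 < h)%N ->
          word_size_ok c w (encode_instance adj k h) ->
          exists t : nat,
            halts_within w P (encode_instance adj k h) t
              (tree_free_edge_deletion G k h) /\
            ((0 < n)%N ->
             t%:R <= M * ((k.+1 ^ k.+2)%N)%:R * n%:R `^ (1 + eps n))].
Proof.
have [C hC] := split_program_correct.
(* The time is linear in [n], so the [o(1)] in the exponent may be 0; the exponent 4 for the word
   size comes from [word_bounds]. *)
exists split_program, 4%N, C%:R, (fun=> 0); split=> //; first exact: cvg_cst.
move=> n G adj k h w sG adjP k0 h0 wok.
have [t [halts le]] := hC n G adj k h w sG adjP k0 h0 wok.
exists t; split=> // n0.
by rewrite addr0 powRr1 ?ler0n // -!natrM ler_nat le.
Qed.
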